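(* Let $Z_1^S(m,n)$ denote the maximal number of zeros of abelian integrals along simple cycles of $f$ of degree $m$ deformed by $g$ of degree $n$, and let $d=\gcd(m,n)$. Then $$Z_1^S(m,n)=\frac{(n-1)(m-1)-(d-1)}{2}.$$
   Context: Let $f\in\mathbb{C}[z]$ be a polynomial of degree $m>1$ and $\Sigma\subset\mathbb{C}$ its finite set of critical values. For $t\in\mathbb{C}\setminus\Sigma$ the set $f^{-1}(t)$ consists of $m$ distinct points $z_1(t),\dots,z_m(t)$, which continue analytically to multivalued algebraic functions on $\mathbb{C}\setminus\Sigma$. A simple cycle of $f$ is a formal difference $C(t)=z_i(t)-z_j(t)$ with $i\ne j$. For $g\in\mathbb{C}[z]$, the abelian integral of $g$ along $C$ is $\int_{C(t)}g=g(z_i(t))-g(z_j(t))$. The number of zeros means the number of isolated $t\in\mathbb{C}\setminus\Sigma$ at which at least one of the (finitely many) branches of this multivalued function vanishes; the maximum is over all $f$ of degree $m$, $g$ of degree $n$ and simple cycles $C$ of $f$. *)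

(* Defs.v *)
From HB Require Import structures.
From mathcomp Require Import all_boot all_order all_algebra.
From mathcomp Require Import complex.
From mathcomp Require Import all_classical all_reals all_analysis.
Import Order.TTheory GRing.Theory Num.Theory.
Import numFieldNormedType.Exports.

Set Implicit Arguments.
Unset Strict Implicit.
Unset Printing Implicit Defensive.

Local Open Scope classical_set_scope.
Local Open Scope card_scope.
Local Open Scope ring_scope.
Local Open Scope complex_scope.

Definition critical_values (R : realType) (f : {poly R[i]}) : set R[i]^o :=
  [set f.[c] | c in [set c | root f^`() c]].

(* A holomorphic branch of the multivalued function f^-1 near [t]; since
   [R[i]^o] is a normed space over [R[i]], [derivable z u 1] is complex
   differentiability. *)
Definition inverse_branch (R : realType) (f : {poly R[i]}) (t : R[i]^o)
    (z : R[i]^o -> R[i]^o) : Prop :=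
  \forall u \near t, derivable z u 1 /\ f.[z u] = u.

(* The cycle z_i - z_j is given by the germs of z_i and z_j at a regular base
   value [t0]; only their values near [t0] matter. *)
Definition simple_cycle (R : realType) (f : {poly R[i]}) (t0 : R[i]^o)
    (zi zj : R[i]^o -> R[i]^o) : Prop :=
  [/\ inverse_branch f t0 zi, inverse_branch f t0 zj & zi t0 != zj t0].

(* [h s] represents, at the point [gamma s], the germ obtained by analytic
   continuation of the germ [z] at [gamma 0] along [gamma] on [0, s]. *)
Definition continuation_along (R : realType) (f : {poly R[i]})
    (gamma : R -> R[i]^o) (z : R[i]^o -> R[i]^o)
    (h : R -> R[i]^o -> R[i]^o) : Prop :=
  [/\ \forall u \near gamma 0, h 0 u = z u,
      forall s : R, s \in `[0, 1] -> inverse_branch f (gamma s) (h s) &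
      forall s : R, s \in `[0, 1] -> \forall s' \near s, s' \in `[0, 1] ->
        \forall u \near gamma s', h s' u = h s u].

Definition path_avoiding (R : realType) (S : set R[i]^o) (t0 t : R[i]^o)
    (gamma : R -> R[i]^o) : Prop :=
  [/\ {within `[0, 1], continuous gamma}, gamma 0 = t0, gamma 1 = t &
      forall s : R, s \in `[0, 1] -> ~ S (gamma s)].

(* [wi - wj] is a branch near [t] of the cycle [zi - zj]: both roots are
   continued along the same path of the complement of the critical values. *)
Definition branch_at (R : realType) (f : {poly R[i]}) (t0 : R[i]^o)
    (zi zj : R[i]^o -> R[i]^o) (t : R[i]^o) (wi wj : R[i]^o -> R[i]^o) : Prop :=
  exists gamma : R -> R[i]^o, exists hi hj : R -> R[i]^o -> R[i]^o,
    [/\ path_avoiding (critical_values f) t0 t gamma,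
        continuation_along f gamma zi hi, continuation_along f gamma zj hj,
        wi = hi 1 & wj = hj 1].

Definition abelian_integral (R : realType) (g : {poly R[i]})
    (zi zj : R[i]^o -> R[i]^o) (t : R[i]^o) : R[i] := g.[zi t] - g.[zj t].

Definition vanishing_set (R : realType) (f g : {poly R[i]}) (t0 : R[i]^o)
    (zi zj : R[i]^o -> R[i]^o) : set R[i]^o :=
  [set t | exists wi wj : R[i]^o -> R[i]^o,
     branch_at f t0 zi zj t wi wj /\ abelian_integral g wi wj t = 0].

(* If the integral vanishes identically, every point of [vanishing_set] is a
   limit point and there are no zeros. *)
Definition zeros (R : realType) (f g : {poly R[i]}) (t0 : R[i]^o)
    (zi zj : R[i]^o -> R[i]^o) : set R[i]^o :=
  isolated (vanishing_set f g t0 zi zj).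

Definition admissible (R : realType) (m n : nat) (f g : {poly R[i]})
    (t0 : R[i]^o) (zi zj : R[i]^o -> R[i]^o) : Prop :=
  [/\ size f = m.+1, size g = n.+1, ~ critical_values f t0 &
      simple_cycle f t0 zi zj].

(* [N] is the maximal number of zeros: it is attained, and every zero set is
   finite with at most [N] elements. *)
Definition is_Z1S (R : realType) (m n N : nat) : Prop :=
  (exists (f g : {poly R[i]}) (t0 : R[i]^o) (zi zj : R[i]^o -> R[i]^o),
     admissible m n f g t0 zi zj /\ zeros f g t0 zi zj #= `I_N) /\
  (forall (f g : {poly R[i]}) (t0 : R[i]^o) (zi zj : R[i]^o -> R[i]^o),
     admissible m n f g t0 zi zj -> zeros f g t0 zi zj #<= `I_N).

(* Main.v *)
Require Import Defs.
From HB Require Import structures.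
From mathcomp Require Import all_boot all_order all_fingroup all_algebra.
From mathcomp Require mpoly.

(** Write [dq g x y] for the divided difference [(g(x) - g(y)) / (x - y)] and
    [N] for the claimed number, so that [2N = (m-1)(n-1) - (d-1)].

    Upper bound.  Let [z_1, ..., z_m] be the roots of [f - t].  The coefficients
    of [k_t(S) = \prod_(i < j) (S + dq g z_i z_j)] are symmetric functions of
    the roots, hence polynomials in [t] ([pair_product_coef]); taking unordered
    pairs is what halves the count.  They have degree at most [N]
    ([pair_product_degree]): for [t = a tau^m] large, where [a] is the leading
    coefficient of [f], the roots lie at bounded distance from the points
    [tau w^i], [w] a primitive [m]-th root of unity ([roots_asymptotics]), so
    that [dq g z_i z_j = O(tau^(n-1))], and even [O(tau^(n-2))] for the
    [m (d-1) / 2] pairs with [w^(in) = w^(jn)]; the total exponent is [m N].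
    Let [k] be the order of vanishing of [k_t(S)] at [S = 0] as a polynomial in
    [S] and [t].  Then at least [k] pairs of each fibre satisfy [g(x) = g(y)],
    and exactly [k] where the coefficient of [S^k] does not vanish.  At such a
    regular value [t] the [k] vanishing pairs must keep vanishing along the
    local branches of the roots, so that [t] is not an isolated zero
    ([isolated_zero_root]).  Isolated zeros are therefore roots of one nonzero
    polynomial of degree at most [N].  This argument covers the case where the
    integral vanishes identically along some other cycles.

    Attaining the bound.  Take [f = X^m - X^(m-1)].  With [q_k] for
    [1 + s + ... + s^(k-1)], the pairs of distinct points of the fibres of [f]
    are parametrized, up to finitely many, by the rational curve
    [x = q_(m-1) / q_m], [y = s x].  As the plane minus a finite set is path
    connected, any two such pairs lying over regular values are joined by a
    continuous motion ([linked_curve]), which means that they are branches of a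
    single cycle.  For [g = X^n + a X] the equation [g(x) = g(y)] reads
    [A(s) + a B(s) = 0], where [A] and [B] are monic of degree [2N] without
    common root ([pencil_factor]).  If [N > 0], then for general [a] it has [2N]
    simple roots outside any given finite set ([generic_pencil]).  Two of them
    give the same value of [t] only when they are equal or inverse to each other:
    for all but finitely many [s], [dq X^n x y] differs from the divided
    differences of all other pairs of its fibre.  That is an algebraic condition
    on [s] ([separating_poly]), so it suffices to check it for one small [s]
    ([separated_pair]).

    Continuation along paths is handled through the relation [linked], that is,
    through continuous motions of pairs of points of fibres; [vanishing_setP]
    translates the zeros of the integral into these terms. *)

Set Implicit Arguments.
Unset Strict Implicit.
Unset Printing Implicit Defensive.

Import Order.TTheory GRing.Theory.
Local Open Scope ring_scope.

(** * Divided differences and symmetric functions of roots *)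

(** The divided difference [(p.[x] - p.[y]) / (x - y)], written as a
    polynomial expression so that it also makes sense for [x = y]. *)
Definition dq (A : comNzRingType) (p : {poly A}) (x y : A) : A :=
  \sum_(k < size p) p`_k * \sum_(a < k) x ^+ (k.-1 - a) * y ^+ a.

Lemma dqP (A : comNzRingType) (p : {poly A}) x y :
  p.[x] - p.[y] = (x - y) * dq p x y.
Proof.
rewrite !horner_coef -sumrB /dq mulr_sumr; apply: eq_bigr => k _.
by rewrite -mulrBr subrXX mulrCA.
Qed.

Lemma dq_sym (A : comNzRingType) (p : {poly A}) x y : dq p x y = dq p y x.
Proof.
apply: eq_bigr => k _; congr (_ * _).
case: {k}(k : nat) => [|k]; first by rewrite !big_ord0.
rewrite (reindex_inj rev_ord_inj) /=; apply: eq_bigr => a _.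
have ha : (a <= k)%N by rewrite -ltnS.
by rewrite subSS subKn // mulrC.
Qed.

Lemma dq_diag (A : comNzRingType) (p : {poly A}) x : dq p x x = p^`().[x].
Proof.
rewrite /dq /deriv horner_poly.
case: (size p) => [|n]; first by rewrite !big_ord0.
rewrite big_ord_recl /= big_ord0 mulr0 add0r; apply: eq_bigr => k _.
rewrite /bump /= add1n add0n /= (eq_bigr (fun=> x ^+ k)); last first.
  by move=> a _; rewrite -exprD subnK // -ltnS.
by rewrite sumr_const card_ord mulrnAr mulrnAl.
Qed.

Lemma dqXn (A : comNzRingType) n (x y : A) :
  dq 'X^n x y = \sum_(a < n) x ^+ (n.-1 - a) * y ^+ a.
Proof.
rewrite /dq size_polyXn big_ord_recr /= coefXn eqxx mul1r big1 ?add0r // => i _.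
by rewrite coefXn ltn_eqF // mul0r.
Qed.

Section PairProduct.
Context (m : nat).

(** A product over unordered pairs is invariant under permutations of the
    indices. *)
Lemma prod_pairs_perm (T : comNzRingType) (F : 'I_m -> 'I_m -> T)
    (s : {perm 'I_m}) : (forall i j, F i j = F j i) ->
  \prod_(p : 'I_m * 'I_m | (p.1 < p.2)%N) F (s p.1) (s p.2) =
  \prod_(p : 'I_m * 'I_m | (p.1 < p.2)%N) F p.1 p.2.
Proof.
move=> Fs.
pose h (u : {perm 'I_m}) (p : 'I_m * 'I_m) :=
  if (u p.1 < u p.2)%N then (u p.1, u p.2) else (u p.2, u p.1).
have hlt u (p : 'I_m * 'I_m) : (p.1 < p.2)%N -> ((h u p).1 < (h u p).2)%N.
  rewrite /h => lp; case: ifP => //= /negbT; rewrite -leqNgt leq_eqVlt.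
  by case/orP => // /eqP /val_inj /perm_inj e; rewrite e ltnn in lp.
have hK (u v : {perm 'I_m}) (p : 'I_m * 'I_m) : cancel u v -> (p.1 < p.2)%N -> h v (h u p) = p.
  case: p => i j /= uK lp; rewrite /h /=.
  by case: (u i < u j)%N => /=; rewrite !uK ?lp // ltnNge (ltnW lp).
rewrite [RHS](reindex_onto (h s) (h s^-1%g)) /=; last first.
  by move=> p lp; apply: hK => // x; rewrite permKV.
apply: eq_big => [p|p lp].
  case: (boolP (p.1 < p.2)%N) => lp; last first.
    apply/esym/negbTE; rewrite negb_and -implybE; apply/implyP => l1.
    apply: contraNN lp => /eqP <-; exact: hlt.
  by rewrite hlt // hK ?eqxx // => x; rewrite permK.
by rewrite /h; case: ifP => //=.
Qed.

End PairProduct.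

Module SymmetricFunctions.
Import mpoly.

(** Symmetric functions of the roots of [f - t] are polynomials in [t].  Here
    they are the coefficients of the polynomial with roots [- dq g z_i z_j], for
    the unordered pairs of roots of [f - t]. *)
Lemma pair_product_coef (F : fieldType) m (f g : {poly F}) :
  size f = m.+1 -> exists K : nat -> {poly F}, forall t (zs : 'I_m -> F),
    f - t%:P = lead_coef f *: \prod_i ('X - (zs i)%:P) -> forall r,
    (K r).[t] = (\prod_(p : 'I_m * 'I_m | (p.1 < p.2)%N)
                  ('X + (dq g (zs p.1) (zs p.2))%:P))`_r.
Proof.
move=> szf; have lf0 : lead_coef f != 0.
  by rewrite lead_coef_eq0 -size_poly_eq0 szf.
pose gm : {poly {mpoly F[m]}} := map_poly (@mpolyC m F) g.
pose D (i j : 'I_m) : {mpoly F[m]} := dq gm 'X_i 'X_j.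
pose KP : {poly {mpoly F[m]}} := \prod_(p : 'I_m * 'I_m | (p.1 < p.2)%N) ('X + (D p.1 p.2)%:P).
have szgm : size gm = size g.
  by apply: size_map_inj_poly; [exact: can_inj (@mpolyCK _ _)|exact: mpolyC0].
have dq_map (B : comNzRingType) (phi : {rmorphism {mpoly F[m]} -> B}) x y :
    phi (dq gm x y) = \sum_(k < size g) phi (g`_k)%:MP *
       \sum_(a < k) phi x ^+ (k.-1 - a) * phi y ^+ a.
  rewrite /dq rmorph_sum szgm /=.
  apply: eq_bigr => k _; rewrite rmorphM /= coef_map /=; congr (_ * _).
  by rewrite rmorph_sum; apply: eq_bigr => a _; rewrite rmorphM !rmorphXn.
have Dsym r : KP`_r \is symmetric.
  apply/issymP => s.
  suff E : map_poly (msym s) KP = KP by rewrite -{2}E coef_map.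
  rewrite /KP rmorph_prod /=.
  transitivity (\prod_(p : 'I_m * 'I_m | (p.1 < p.2)%N)
                   ('X + (D (s p.1) (s p.2))%:P : {poly {mpoly F[m]}})).
    apply: eq_bigr => p _; rewrite rmorphD /= map_polyX map_polyC /=.
    congr (_ + _%:P); rewrite /D dq_map /dq szgm.
    apply: eq_bigr => k _; rewrite coef_map /= ; congr (_ * _).
      by rewrite /msym mmapC.
    have msymXi i : msym s ('X_i : {mpoly F[m]}) = 'X_(s i).
      rewrite msymX; congr ('X_[_]); apply/mnmP => j.
      by rewrite mnmE !mnm1E -(inj_eq (@perm_inj _ s)) permKV.
    by apply: eq_bigr => a _; rewrite !msymXi.
  apply: (prod_pairs_perm (F := fun i j => 'X + (D i j)%:P)) => i j.
  by rewrite /D dq_sym.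
(* Viete: [h 'X i] is the elementary symmetric function of the roots of degree
   [i.+1], as a polynomial in [t] *)
pose h (t : {poly F}) (i : 'I_m) : {poly F} :=
  ((-1) ^+ i.+1 / lead_coef f) *: ((f`_(m - i.+1))%:P - (t *+ (m - i.+1 == 0)%N)).
exists (fun r => mmap (@polyC F) (h 'X) (symf KP`_r)) => t zs fE r.
have zE : \prod_(c <- [tuple zs i | i < m]) ('X - c%:P) =
          (lead_coef f)^-1 *: (f - t%:P).
  rewrite fE scalerA mulVf // scale1r big_tuple.
  by apply: eq_bigr => i _; rewrite tnth_mktuple.
have eE (i : 'I_m) : (mesym m F i.+1).@[zs] = (h 'X i).[t].
  have := mroots_coeff [tuple zs i | i < m] (lift ord0 i).
  rewrite zE lift0 => /(congr1 (fun x => (-1) ^+ i.+1 * x)).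
  rewrite mulrA -expr2 sqrr_sign mul1r (meval_eq (v2 := zs)); last first.
    by move=> j; rewrite tnth_mktuple.
  move=> <-; rewrite /h coefZ coefB coefC.
  rewrite !(hornerZ, hornerD, hornerN, hornerMn, hornerC, hornerX) mulrA.
  by case: eqP => _ /=; rewrite !(mulr1n, mulr0n, hornerE).
transitivity ((KP`_r).@[zs]); last first.
  rewrite -(coef_map (meval zs)) /= /KP rmorph_prod /=; congr (polyseq _)`_r.
  apply: eq_bigr => p _; rewrite rmorphD /= map_polyX map_polyC /=.
  congr (_ + _%:P); rewrite /D dq_map; apply: eq_bigr => k _ /=.
  by rewrite mevalC; congr (_ * _); apply: eq_bigr => a _; rewrite !mevalXU.
rewrite {2}(symfP (Dsym r)) comp_mpoly_meval mevalE /mmap horner_sum.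
apply: eq_bigr => mm _; rewrite hornerM hornerC; congr (_ * _).
rewrite /mmap1 horner_prod; apply: eq_bigr => i _.
by rewrite horner_exp tnth_mktuple eE.
Qed.

End SymmetricFunctions.

From mathcomp Require Import cyclic separable cyclotomic.
From mathcomp Require Import complex.
From mathcomp Require Import all_classical all_reals all_analysis.
From mathcomp Require Import zify ring lra.

Import Num.Theory.
Import numFieldNormedType.Exports.
Local Open Scope classical_set_scope.
Local Open Scope complex_scope.
Local Open Scope card_scope.
Local Open Scope ring_scope.

(** * Polynomials given by their roots *)

Lemma size_subC (A : nzRingType) (f : {poly A}) t :
  (1 < size f)%N -> size (f - t%:P) = size f.
Proof.
move=> sf; rewrite size_polyDl // size_polyN.
exact: leq_ltn_trans (size_polyC_leq1 _) sf.
Qed.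

Lemma lead_coef_subC (A : nzRingType) (f : {poly A}) t :
  (1 < size f)%N -> lead_coef (f - t%:P) = lead_coef f.
Proof.
move=> sf; rewrite lead_coefDl // size_polyN.
exact: leq_ltn_trans (size_polyC_leq1 _) sf.
Qed.

Lemma distinct_roots_factor (F : fieldType) m (f : {poly F}) (t : F)
    (zs : 'I_m -> F) :
  (0 < m)%N -> size f = m.+1 -> injective zs -> (forall i, f.[zs i] = t) ->
  f - t%:P = lead_coef f *: \prod_i ('X - (zs i)%:P).
Proof.
move=> m0 sf zi ft; have sf1 : (1 < size f)%N by rewrite sf ltnS.
have := @all_roots_prod_XsubC _ (f - t%:P) [seq zs i | i <- enum 'I_m].
rewrite size_subC // lead_coef_subC // sf size_map size_enum_ord => -> //.
- by rewrite big_map big_enum.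
- by apply/allP => _ /mapP[i _ ->]; rewrite /root !hornerE ft subrr.
- by rewrite uniq_rootsE map_inj_uniq ?enum_uniq.
Qed.

Lemma factor_root (F : fieldType) m (f : {poly F}) (t z : F) (zs : 'I_m -> F) :
  f - t%:P = lead_coef f *: \prod_i ('X - (zs i)%:P) -> f != 0 ->
  f.[z] = t -> exists i, z = zs i.
Proof.
move=> fE f0 e; have : root (f - t%:P) z by rewrite /root !hornerE e subrr.
rewrite fE rootZ ?lead_coef_eq0 // /root horner_prod prodf_seq_eq0.
by move=> /hasP[i _ /=]; rewrite hornerXsubC subr_eq0 => /eqP ->; exists i.
Qed.

Lemma factor_value (F : fieldType) m (f : {poly F}) (t : F) (zs : 'I_m -> F) i :
  f - t%:P = lead_coef f *: \prod_i ('X - (zs i)%:P) -> f.[zs i] = t.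
Proof.
move=> fE; apply/eqP; rewrite -subr_eq0.
have -> : f.[zs i] - t = (f - t%:P).[zs i] by rewrite !hornerE.
by rewrite fE hornerZ horner_prod (bigD1 i) //= hornerXsubC subrr mul0r mulr0.
Qed.

Lemma simple_split (K : closedFieldType) (p : {poly K}) D : size p = D.+1 ->
  (forall x, root p x -> p^`().[x] != 0) ->
  exists rs : seq K, [/\ uniq rs, size rs = D &
     p = lead_coef p *: \prod_(z <- rs) ('X - z%:P)].
Proof.
move=> sp simple; have [rs rsE] := closed_field_poly_normal p.
have lp0 : lead_coef p != 0 by rewrite lead_coef_eq0 -size_poly_eq0 sp.
exists rs; split => //.
  rewrite -separable_prod_XsubC -(@eqp_separable _ p); last first.
    by rewrite [X in X %= _]rsE eqp_scale.
  by rewrite unlock; apply: Pdiv.ClosedField.root_coprimep.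
by apply: succn_inj; rewrite -sp rsE size_scale // size_prod_XsubC.
Qed.

(** The order of vanishing at [0] of a product of monic linear factors. *)
Lemma XaddC_prod_lowest (F : idomainType) (s : seq F) :
  (forall r, (r < count (pred1 0%R) s)%N -> (\prod_(c <- s) ('X + c%:P))`_r = 0) /\
  (\prod_(c <- s) ('X + c%:P))`_(count (pred1 0%R) s) != 0.
Proof.
elim: s => [|c s [IH1 IH2]]; first by rewrite big_nil; split=> //; rewrite coefC oner_eq0.
rewrite big_cons /=; have [->|c0] := eqVneq c 0; rewrite /= ?eqxx ?(negbTE c0) ?add0n.
  rewrite addr0 add1n; split => [[|r] rs|]; rewrite coefXM //=; exact: IH1.
split => [r rs|].
  rewrite mulrDl coefD coefXM coefCM (IH1 r rs) mulr0 addr0; case: eqP => // r0.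
  by apply: IH1; apply: leq_ltn_trans rs; exact: leq_pred.
rewrite mulrDl coefD coefXM coefCM.
case: (count (pred1 0%R) s =P 0%N) => [_|r0]; first by rewrite add0r mulf_neq0.
by rewrite IH1 ?add0r ?mulf_neq0 // prednK // lt0n; apply/eqP.
Qed.

Lemma deriv_prod_XaddC (K : idomainType) (I : finType) (P : pred I) (c : I -> K) i0 : P i0 ->
  (forall i, P i -> i != i0 -> c i != c i0) ->
  (\prod_(i | P i) ('X + (c i)%:P))^`().[- c i0] != 0.
Proof.
move=> Pi0 ci; rewrite (bigD1 i0) //= derivM derivD derivX derivC addr0 mul1r.
rewrite hornerD hornerM !hornerE [X in X * _]addrC subrr mul0r addr0 horner_prod.
apply/prodf_neq0 => i /andP[Pi ii0]; rewrite !hornerE addrC subr_eq0; exact: ci.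
Qed.

Lemma deriv_prod_XaddC_double (K : idomainType) (I : finType) (P : pred I) (c : I -> K) i j :
  P i -> P j -> i != j -> c i = c j ->
  (\prod_(i | P i) ('X + (c i)%:P))^`().[- c i] = 0.
Proof.
move=> Pi Pj ij cij; rewrite (bigD1 i) //= (bigD1 j) /=; last by rewrite Pj eq_sym.
rewrite !derivM !(hornerD, hornerM, hornerX, hornerC) -cij addNr.
by rewrite !(mul0r, mulr0, addr0).
Qed.

(** * Inverse branches of a polynomial *)

Section LocalInverse.
Context {K : numClosedFieldType}.
Implicit Types (f p : {poly K}) (x y z u w : K).

Lemma cvg_bigsum {T} {F : set_system T} {FF : Filter F} I (r : seq I) (P : pred I)
    (f : I -> T -> K^o) (a : I -> K^o) :
  (forall i, P i -> f i @ F --> a i) ->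
  (fun t => \sum_(i <- r | P i) f i t) @ F --> \sum_(i <- r | P i) a i.
Proof.
move=> fa; elim: r => [|i r IH].
  by rewrite big_nil; under eq_fun do rewrite big_nil; exact: cvg_cst.
rewrite big_cons; under eq_fun do rewrite big_cons.
by case: ifP => // Pi; apply: cvgD => //; exact: fa.
Qed.

Lemma cvg_pow {T} {F : set_system T} {FF : Filter F} k (z : T -> K^o) (a : K^o) :
  z @ F --> a -> (fun t => z t ^+ k : K^o) @ F --> (a ^+ k : K^o).
Proof.
move=> za; elim: k => [|k IH]; first exact: cvg_cst.
by under eq_fun do rewrite exprS; rewrite exprS; apply: cvgM.
Qed.

Lemma cvg_horner {T} {F : set_system T} {FF : Filter F} p (z : T -> K^o) (a : K^o) :
  z @ F --> a -> (fun t => p.[z t] : K^o) @ F --> (p.[a] : K^o).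
Proof.
move=> za; rewrite horner_coef.
under eq_fun do rewrite horner_coef.
by apply: cvg_bigsum => i _; apply: cvgM; [exact: cvg_cst|exact: cvg_pow].
Qed.

Lemma cvg_dq {T} {F : set_system T} {FF : Filter F} p (z w : T -> K^o) (a b : K^o) :
  z @ F --> a -> w @ F --> b -> (fun t => dq p (z t) (w t) : K^o) @ F --> (dq p a b : K^o).
Proof.
move=> za wb; rewrite /dq; apply: cvg_bigsum => i _; apply: cvgM; first exact: cvg_cst.
by apply: cvg_bigsum => j _; apply: cvgM; exact: cvg_pow.
Qed.

(** Some root of [p] is as close to [x] as the size of [p.[x]] demands. *)
Lemma near_root p x : p != 0 ->
  (1 < size p)%N ->
  exists2 z, root p z & `|lead_coef p| * `|x - z| ^+ (size p).-1 <= `|p.[x]|.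
Proof.
move=> p0 sp; have [rs pE] := closed_field_poly_normal p.
have lp : lead_coef p != 0 by rewrite lead_coef_eq0.
have srs : size rs = (size p).-1.
  by rewrite {1}pE size_scale // size_prod_XsubC.
pose near z := `|lead_coef p| * `|x - z| ^+ (size p).-1 <= `|p.[x]|.
have [/hasP[z zrs zle]|/hasPn H] := boolP (has near rs).
  exists z => //; rewrite pE rootZ // root_prod_XsubC //.
(* otherwise the product of the distances to the roots would be too large *)
exfalso.
have px : `|p.[x]| = `|lead_coef p| * \prod_(z <- rs) `|x - z|.
  rewrite {1}pE hornerZ normrM horner_prod normr_prod; congr (_ * _).
  by apply: eq_bigr => z _; rewrite hornerXsubC.
have lt z : z \in rs -> \prod_(y <- rs) `|x - y| < `|x - z| ^+ (size rs).
  move=> zrs; have := H _ zrs; rewrite /near -srs px ler_pM2l ?normr_gt0 //.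
  by rewrite -real_ltNge ?rpredX ?rpred_prod // => *; rewrite ?normr_real.
have rs0 : (0 < size rs)%N by rewrite srs; case: (size p) sp => [|[]].
have : (\prod_(y <- rs) `|x - y|) ^+ size rs < \prod_(z <- rs) (`|x - z| ^+ size rs).
  have -> : (\prod_(y <- rs) `|x - y|) ^+ size rs =
      \prod_(z <- rs) \prod_(y <- rs) `|x - y|.
    by rewrite big_const_seq count_predT iter_mulr_1.
  rewrite [X in X < _]big_seq [X in _ < X]big_seq.
  apply: ltr_prod.
    apply/hasP; exists (nth 0 rs 0); first by rewrite mem_nth.
    by rewrite mem_nth.
  by move=> z zrs; rewrite lt // prodr_ge0.
by rewrite prodrXl ltxx.
Qed.

(** Roots depend continuously on the constant term. *)
Lemma near_preimage f x0 (W : set K^o) : (1 < size f)%N -> nbhs (x0 : K^o) W ->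
  \forall u \near (f.[x0] : K^o), exists2 w, W w & f.[w] = u.
Proof.
move=> sf /nbhs_ballP[r /= r0 rW].
have f0 : f != 0 by apply: contraTneq sf => ->; rewrite size_poly0.
have e0 : 0 < `|lead_coef f| * r ^+ (size f).-1.
  by rewrite mulr_gt0 ?normr_gt0 ?lead_coef_eq0 ?exprn_gt0.
near=> u.
have sfu := size_subC u sf; have lfu := lead_coef_subC u sf.
have [||z zr zle] := @near_root (f - u%:P) x0; rewrite ?sfu //.
  by rewrite -size_poly_gt0 sfu ltnW.
exists z; last by move: zr; rewrite /root !hornerE subr_eq0 => /eqP.
apply: rW; rewrite /ball /= -(@ltr_pXn2r _ (size f).-1) ?nnegrE ?(ltW r0) //.
  rewrite -(@ltr_pM2l _ `|lead_coef f|) ?normr_gt0 ?lead_coef_eq0 //.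
  rewrite -lfu -sfu; apply: le_lt_trans zle _; rewrite lfu sfu !hornerE.
  by near: u; apply: cvgr_dist_lt.
by case: (size f) sf => [|[]].
Unshelve. all: by end_near. Qed.

Lemma local_injectivity f x0 : f^`().[x0] != 0 ->
  exists2 r : K, 0 < r &
    forall z w, ball (x0 : K^o) r z -> ball (x0 : K^o) r w -> dq f z w != 0.
Proof.
move=> fx0.
have : \forall p \near ((x0 : K^o), (x0 : K^o)), dq f p.1 p.2 != 0.
  have c : (fun p : K^o * K^o => dq f p.1 p.2 : K^o) @ ((x0 : K^o), (x0 : K^o)) -->
      (dq f x0 x0 : K^o).
    by apply: cvg_dq; [exact: cvg_fst|exact: cvg_snd].
  by apply: (cvgr_neq0 _ c); rewrite dq_diag.
case=> -[U V] /= [/nbhs_ballP[r1 /= r10 r1U] /nbhs_ballP[r2 /= r20 r2V]] UV.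
have [r [r0 [rr1 rr2]]] : exists r : K, 0 < r /\ r <= r1 /\ r <= r2.
  have [h|h] := real_leP (gtr0_real r10) (gtr0_real r20); first by exists r1.
  by exists r2; rewrite (ltW h).
exists r => // z w zb wb.
apply: (UV (z, w)); split => /=.
  by apply: r1U; apply: le_ball zb; exact: rr1.
by apply: r2V; apply: le_ball wb; exact: rr2.
Qed.

Lemma deriv_neq0_size f x0 : f^`().[x0] != 0 -> (1 < size f)%N.
Proof.
apply: contraNT; rewrite -leqNgt => /size1_polyC ->.
by rewrite derivC horner0.
Qed.

(** Inverse function theorem for polynomials. *)
Lemma local_inverse f x0 : f^`().[x0] != 0 ->
  exists z : K^o -> K^o, z f.[x0] = x0 /\
    \forall u \near (f.[x0] : K^o), derivable z u 1 /\ f.[z u] = u.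
Proof.
move=> fx0; have sf := deriv_neq0_size fx0.
have [r r0 inj] := local_injectivity fx0.
have xb : ball (x0 : K^o) r x0 by exact: ballxx.
have injV z w : ball (x0 : K^o) r z -> ball (x0 : K^o) r w -> f.[z] = f.[w] -> z = w.
  move=> zb wb e; have := dqP f z w; rewrite e subrr => /esym/eqP.
  by rewrite mulf_eq0 (negbTE (inj _ _ zb wb)) orbF subr_eq0 => /eqP.
pose z u : K^o := xget x0 [set w | ball (x0 : K^o) r w /\ f.[w] = u].
have zP u w : ball (x0 : K^o) r w -> f.[w] = u -> z u = w.
  move=> wb fw; rewrite /z; case: xgetP => [v _ [vb fv]|/(_ w)[]//].
  by apply: injV => //; rewrite fv fw.
exists z; split; first exact: zP.
have : \forall u \near (f.[x0] : K^o), exists2 w, ball (x0 : K^o) r w & f.[w] = u.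
  by apply: near_preimage => //; exact: nbhsx_ballx.
apply: filterS => u [w wb fw].
have zu := zP _ _ wb fw; split; last by rewrite zu.
(* continuity of [z]; its difference quotient at [u] is the inverse of a divided
   difference of [f] *)
have zc : z @ (u : K^o) --> (w : K^o).
  move=> A /= wA; rewrite -fw.
  have : nbhs (w : K^o) (A `&` ball (x0 : K^o) r).
    by apply: filterI => //; apply: open_nbhs_nbhs; split => //; exact: ball_open.
  move=> /(near_preimage sf) H; change (nbhs (f.[w] : K^o) (z @^-1` A)).
  apply: filterS H => v [y [yA yb] fy].
  by rewrite /= (zP _ _ yb fy).
apply/cvg_ex; exists ((dq f w w)^-1).
have shc : (fun h : K^o => h *: (1 : K^o) + u) @ 0^' --> (u : K^o).
  have -> : (fun h : K^o => h *: (1 : K^o) + u) = (fun h : K^o => h + u : K^o).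
    by apply/funext => h; congr (_ + _); exact: mulr1.
  rewrite -[X in _ --> X]add0r.
  have h : (fun h : K^o => h + u : K^o) @ (0 : K^o) --> (0 + u : K^o).
    apply: (@cvgD K K^o K^o (nbhs (0 : K^o)) _ idfun (cst (u : K^o))).
      exact: cvg_id.
    exact: cvg_cst.
  by apply: cvg_trans h; apply: cvg_app; exact: cvg_within.
have zsh : (fun h : K^o => z (h *: (1 : K^o) + u)) @ 0^' --> (w : K^o).
  exact: cvg_comp shc zc.
have dc : (fun h : K^o => (dq f (z (h *: (1 : K^o) + u)) w)^-1 : K^o) @ 0^' -->
    ((dq f w w)^-1 : K^o).
  by apply: cvgV; [exact: inj | apply: cvg_dq => //; exact: cvg_cst].
apply: cvg_trans dc; apply: near_eq_cvg.
have fz : \forall h \near (0 : K^o)^', f.[z (h *: (1 : K^o) + u)] = h *: (1 : K^o) + u.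
  apply: (shc [set v | f.[z v] = v]).
  have : nbhs (w : K^o) (ball (x0 : K^o) r).
    by apply: open_nbhs_nbhs; split => //; exact: ball_open.
  move=> /(near_preimage sf); rewrite fw; apply: filterS => v [y yb fy].
  by rewrite /= (zP _ _ yb fy).
have zb : \forall h \near (0 : K^o)^', ball (x0 : K^o) r (z (h *: (1 : K^o) + u)).
  by apply: (zsh (ball (x0 : K^o) r)); apply: open_nbhs_nbhs; split => //; exact: ball_open.
near=> h.
have h0 : h != 0 by near: h; exact: nbhs_dnbhs_neq.
have fzh : f.[z (h *: (1 : K^o) + u)] = h *: (1 : K^o) + u by near: h.
have zbh : ball (x0 : K^o) r (z (h *: (1 : K^o) + u)) by near: h.
have d0 := inj _ _ zbh wb.
have := dqP f (z (h *: (1 : K^o) + u)) w.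
rewrite fzh fw addrK zu /= => e.
rewrite /GRing.scale /= in e *.
rewrite mulr1 in e *.
apply: (mulfI h0); rewrite mulVKf //.
apply: (canLR (mulfK _)); last exact: e.
by move: d0; rewrite /GRing.scale /= mulr1.
Unshelve. all: by end_near. Qed.

End LocalInverse.

(** * Motions of pairs of points of a fibre *)

Section Paths.
Context {R : realType}.
Local Notation C := (R[i]^o).
Implicit Types (f g : {poly R[i]}).

(** The critical values are the roots of a polynomial. *)
Lemma critical_values_poly f : f^`() != 0 ->
  exists2 s : {poly R[i]}, s != 0 & forall t, critical_values f t <-> root s t.
Proof.
move=> df0; have [rs dfE] := closed_field_poly_normal f^`().
have rsP c : root f^`() c = (c \in rs).
  by rewrite dfE rootZ ?lead_coef_eq0 // root_prod_XsubC.
exists (\prod_(t <- [seq f.[c] | c <- rs]) ('X - t%:P)).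
  by rewrite prodf_seq_neq0; apply/allP => t _; rewrite polyXsubC_eq0.
move=> t; rewrite root_prod_XsubC; split.
  by move=> [c /=]; rewrite rsP => crs <-; exact: map_f.
by move=> /mapP[c crs ->]; exists c => //=; rewrite rsP.
Qed.

Lemma regular_deriv f x : ~ critical_values f f.[x] -> f^`().[x] != 0.
Proof. by move=> h; apply/negP => /eqP e; apply: h; exists x => //=; apply/rootP. Qed.

Lemma regular_near f (t : C) : f^`() != 0 -> ~ critical_values f t ->
  \forall u \near t, ~ critical_values f u.
Proof.
move=> df0 ht; have [s s0 sP] := critical_values_poly df0.
have c : (fun u : C => s.[u] : C) @ t --> (s.[t] : C).
  by apply: (@cvg_horner _ _ (nbhs t) _ s (fun u : C => u) t); exact: cvg_id.
have : \forall u \near t, (s.[u] : C) != 0.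
  by apply: (cvgr_neq0 _ c); apply/negP => /eqP/rootP /sP.
by apply: filterS => u su /sP /rootP e; rewrite e eqxx in su.
Qed.

Lemma inverse_branch_cvg f (t : C) z : inverse_branch f t z -> z @ t --> z t.
Proof.
move=> /nbhs_singleton[/derivable1_diffP dz _].
exact: differentiable_continuous.
Qed.

Lemma inverse_branch_near f (t : C) z : inverse_branch f t z ->
  \forall u \near t, inverse_branch f u z.
Proof. by move=> h; apply: nbhs_interior h. Qed.

Lemma inverse_branchE f (t : C) z : inverse_branch f t z -> f.[z t] = t.
Proof. by move=> /nbhs_singleton[]. Qed.

Lemma local_injectivity_near f (x0 : C) : f^`().[x0] != 0 ->
  \forall x \near x0 & y \near x0, f.[x] = f.[y] -> x = y.
Proof.
move=> /local_injectivity[r r0 inj].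
exists (ball x0 r, ball x0 r) => /=; first by split; exact: nbhsx_ballx.
move=> [x y] [/= xb yb] e; have := dqP f x y; rewrite e subrr => /esym/eqP.
by rewrite mulf_eq0 (negbTE (inj _ _ xb yb)) orbF subr_eq0 => /eqP.
Qed.

(** Two inverse branches with the same value at [t] have the same germ. *)
Lemma inverse_branch_unique f (t : C) z w : ~ critical_values f t ->
  inverse_branch f t z -> inverse_branch f t w -> z t = w t ->
  \forall u \near t, z u = w u.
Proof.
move=> ht bz bw e.
have dz : f^`().[z t] != 0 by apply: regular_deriv; rewrite (inverse_branchE bz).
have [[U V] /= [zU zV] UV] := local_injectivity_near dz.
have zc := inverse_branch_cvg bz.
have wc := inverse_branch_cvg bw; rewrite -e in wc.
have h1 : \forall u \near t, U (z u) by exact: zc.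
have h2 : \forall u \near t, V (w u) by exact: wc.
near=> u.
apply: (UV (z u, w u)); first by split => /=; near: u.
rewrite /=.
have -> : f.[z u] = u by near: u; apply: filterS bz => ? [].
have -> // : f.[w u] = u by near: u; apply: filterS bw => ? [].
Unshelve. all: by end_near. Qed.

(** [linked f p q]: the pair [p] of points of a regular fibre of [f] can be
    moved continuously to the pair [q] through pairs of points of regular
    fibres. *)
Definition linked f (p q : C * C) := exists x y : R -> C,
  [/\ continuous x, continuous y, (x 0, y 0) = p, (x 1, y 1) = q &
      forall s, f.[x s] = f.[y s] /\ ~ critical_values f f.[x s]].

(** The retraction of the line onto the unit interval; composing with it turns
    paths on the unit interval into globally defined continuous functions. *)
Definition clamp (s : R) : R := Num.max 0 (Num.min 1 s).

Lemma clamp_itv s : clamp s \in `[0, 1].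
Proof. by rewrite in_itv /= /clamp le_max lexx /= ge_max ler01 ge_min lexx. Qed.

Lemma clamp_id s : s \in `[0, 1] -> clamp s = s.
Proof. by rewrite in_itv /= /clamp => /andP[s0 s1]; rewrite min_r // max_r. Qed.

Lemma clamp_le0 s : s <= 0 -> clamp s = 0.
Proof. by move=> h; rewrite /clamp min_r ?max_l // (le_trans h). Qed.

Lemma clamp_ge1 s : 1 <= s -> clamp s = 1.
Proof. by move=> h; rewrite /clamp min_l ?max_r. Qed.

Lemma clamp_continuous : continuous clamp.
Proof.
move=> s; apply: (@continuous_max R R (fun=> 0) (fun s => Num.min 1 s)).
  exact: cvg_cst.
by apply: (@continuous_min R R (fun=> 1) id); [exact: cvg_cst|exact: cvg_id].
Qed.

Lemma continuous_clamp (T : topologicalType) (h : R -> T) :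
  {within `[0, 1], continuous h} -> continuous (h \o clamp).
Proof.
move=> /subspace_continuousP ch s A /= hA.
have := ch (clamp s) (clamp_itv s) A hA.
rewrite /within /= => h1; change (nbhs s (fun u => A (h (clamp u)))).
have h2 : nbhs s (clamp @^-1` _) := @clamp_continuous s _ h1.
by apply: filterS h2 => u; apply; exact: clamp_itv.
Qed.

Lemma linked_trans f p q r : linked f p q -> linked f q r -> linked f p r.
Proof.
move=> [x1 [y1 [cx1 cy1 p1 q1 h1]]] [x2 [y2 [cx2 cy2 q2 r2 h2]]].
(* a formula for concatenation that is manifestly continuous: on each half one
   of the first two terms is constant and cancels the third *)
pose paste (a b : R -> C) s := a (clamp (2 * s)) + b (clamp (2 * s - 1)) - a 1.
have cont (a b : R -> C) : continuous a -> continuous b -> continuous (paste a b).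
  move=> ca cb.
  have lin (e : R) : continuous (fun s : R => 2 * s - e : R^o).
    move=> s; apply: (@cvgB R R^o R (nbhs s) _ (fun s => 2 * s) (fun=> e)).
    2: exact: cvg_cst.
    by apply: (@cvgM R R (nbhs s) _ (fun=> 2) id); [exact: cvg_cst|exact: cvg_id].
  have c2 (e : R) : continuous (fun s : R => clamp (2 * s - e)).
    move=> s; apply: (@continuous_comp _ _ _ (fun s : R => 2 * s - e : R) clamp).
      exact: lin.
    exact: clamp_continuous.
  have ca' : continuous (a \o (fun s => clamp (2 * s))).
    move=> s; apply: continuous_comp; last exact: ca.
    by have := @c2 0 s; rewrite /continuous_at subr0; under eq_fun do rewrite subr0.
  have cb' : continuous (b \o (fun s => clamp (2 * s - 1))).
    by move=> s; apply: continuous_comp; [exact: c2|exact: cb].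
  by move=> s; exact: cvgB (cvgD (ca' s) (cb' s)) (cvg_cst (a 1)).
have pE (a b : R -> C) s : a 1 = b 0 ->
    paste a b s = if s <= 1 / 2 then a (clamp (2 * s)) else b (clamp (2 * s - 1)).
  move=> ab; rewrite /paste; case: ifPn => hs.
    by rewrite (@clamp_le0 (2 * s - 1)) ?ab ?addrK //; lra.
  rewrite (@clamp_ge1 (2 * s)) ?(addrC (a 1)) ?addrK //.
  by move: hs; rewrite -ltNge; lra.
have [x12 y12] : x1 1 = x2 0 /\ y1 1 = y2 0.
  by move: q1; rewrite -q2 => -[-> ->].
have e0 : clamp (2 * 0) = 0 by rewrite mulr0 clamp_le0.
have e1 : clamp (2 * 1 - 1) = 1 by rewrite clamp_ge1 //; lra.
have l0 : (0 : R) <= 1 / 2 by lra.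
have l1 : ((1 : R) <= 1 / 2) = false by apply/negbTE; rewrite -ltNge; lra.
exists (paste x1 x2), (paste y1 y2); split.
- exact: cont.
- exact: cont.
- by rewrite !pE // l0 e0.
- by rewrite !pE // l1 e1.
- by move=> s; rewrite !pE //; case: ifP.
Qed.

Lemma linked_eq_fibre f p q : linked f p q ->
  f.[q.1] = f.[q.2] /\ ~ critical_values f f.[q.1].
Proof. by move=> [x [y [_ _ _ <- h]]]; exact: h. Qed.

(** Distinct points of a fibre stay distinct: the set of parameters where the
    two points agree is closed, and open by local injectivity. *)
Lemma linked_neq f p q : linked f p q -> p.1 != p.2 -> q.1 != q.2.
Proof.
move=> [x [y [cx cy <- <- h]]] /= xy0.
apply/eqP => e1.
have cxy : continuous (fun s => x s - y s : C).
  by move=> s; apply: cvgB; [exact: cx|exact: cy].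
pose E := [set s : R | x s = y s].
have op : open E.
  rewrite openE => s Es.
  have dx : f^`().[x s] != 0 by apply: regular_deriv; exact: (h s).2.
  have [[U V] /= [xU xV] UV] := local_injectivity_near dx.
  have h1 : \forall u \near s, U (x u) by exact: cx.
  have h2 : \forall u \near s, V (y u) by apply: cy; rewrite -Es.
  rewrite /interior; near=> u.
  apply: (UV (x u, y u)); first by split => /=; near: u.
  exact: (h u).1.
have cl : closed E.
  rewrite -openC openE => s /= /eqP Es; rewrite -subr_eq0 in Es.
  have h1 : \forall u \near s, x u - y u != 0 := cvgr_neq0 _ (cxy s) Es.
  change (\forall u \near s, ~ E u); near=> u.
  have : x u - y u != 0 by near: u; exact: h1.
  by rewrite subr_eq0 => /eqP hxy; exact: hxy.
have : connected [set: R] by apply/connected_intervalP.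
move=> /(_ E) H.
have : E = [set: R].
  apply: H; first by exists 1.
  by exists E => //; rewrite setTI.
  by exists E => //; rewrite setTI.
move=> /seteqP[_ /(_ 0 I)] /= e0; by rewrite e0 eqxx in xy0.
Unshelve. all: by end_near. Qed.

End Paths.
Section Vanishing.
Context {R : realType}.
Local Notation C := (R[i]^o).
Implicit Types (f g : {poly R[i]}).

(** The values at the moving point of the continued germs form a continuous
    motion. *)
Lemma continuation_lift f (gamma : R -> C) z h :
  {within `[0, 1], continuous gamma} -> continuation_along f gamma z h ->
  continuous (fun s => h (clamp s) (gamma (clamp s))).
Proof.
move=> /continuous_clamp cg [_ hb hc] s.
have bc := hb _ (clamp_itv s).
have cc : (fun s' => h (clamp s) (gamma (clamp s'))) @ s --> h (clamp s) (gamma (clamp s)).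
  apply: (@continuous_comp _ _ _ (gamma \o clamp) (h (clamp s))); first exact: cg.
  exact: inverse_branch_cvg bc.
apply: cvg_trans cc; apply: near_eq_cvg.
have h1 := hc _ (clamp_itv s).
have h2 : \forall s' \near s, clamp s' \in `[0, 1] ->
    \forall u \near gamma (clamp s'), h (clamp s') u = h (clamp s) u.
  exact: (@clamp_continuous R s _ h1).
near=> s'.
have h3 : clamp s' \in `[0, 1] ->
    \forall u \near gamma (clamp s'), h (clamp s') u = h (clamp s) u.
  by near: s'; exact: h2.
by rewrite (nbhs_singleton (h3 (clamp_itv _))).
Unshelve. all: by end_near. Qed.

Lemma branch_at_linked f (t0 t : C) zi zj wi wj :
  branch_at f t0 zi zj t wi wj -> linked f (zi t0, zj t0) (wi t, wj t) /\
  f.[wi t] = t.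
Proof.
move=> [gamma [hi [hj [[cg g0 g1 gS] ci cj -> ->]]]].
have i0 : (0 : R) \in `[0, 1] by rewrite in_itv /= lexx ler01.
have i1 : (1 : R) \in `[0, 1] by rewrite in_itv /= lexx ler01.
have [ci0 ci1 _] := ci; have [cj0 cj1 _] := cj.
have fi s : f.[hi (clamp s) (gamma (clamp s))] = gamma (clamp s).
  by apply: inverse_branchE; apply: ci1; exact: clamp_itv.
have fj s : f.[hj (clamp s) (gamma (clamp s))] = gamma (clamp s).
  by apply: inverse_branchE; apply: cj1; exact: clamp_itv.
split; last by rewrite -g1; apply: inverse_branchE; exact: ci1.
exists (fun s => hi (clamp s) (gamma (clamp s))), (fun s => hj (clamp s) (gamma (clamp s))).
split.
- exact: continuation_lift ci.
- exact: continuation_lift cj.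
- by rewrite clamp_id // (nbhs_singleton ci0) (nbhs_singleton cj0) g0.
- by rewrite clamp_id // g1.
- by move=> s; rewrite fi fj; split => //; apply: gS; exact: clamp_itv.
Qed.

(** Conversely, a motion of a point through regular fibres carries an analytic
    continuation of germs. *)
Lemma lift_continuation f (x : R -> C) z : continuous x ->
  (forall s, ~ critical_values f f.[x s]) ->
  inverse_branch f f.[x 0] z -> z f.[x 0] = x 0 ->
  exists2 h, continuation_along f (fun s => f.[x s]) z h & h 1 f.[x 1] = x 1.
Proof.
move=> cx hx bz z0.
have /choice[h hP] : forall s, exists b : C -> C,
    b f.[x s] = x s /\ inverse_branch f f.[x s] b.
  by move=> s; apply: local_inverse; exact: regular_deriv.
have hE s := (hP s).1; have hb s := (hP s).2.
exists h; last exact: hE.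
split; [|by move=> s _; exact: hb|move=> s _].
  apply: inverse_branch_unique; [exact: hx|exact: hb|exact: bz|].
  by rewrite hE z0.
have dx : f^`().[x s] != 0 by exact: regular_deriv.
have [[U V] /= [xU xV] UV] := local_injectivity_near dx.
have cf : (fun s' => f.[x s'] : C) @ s --> (f.[x s] : C).
  by apply: cvg_horner; exact: cx.
have h1 : \forall s' \near s, U (x s') by exact: cx.
have h2 : \forall s' \near s, V (h s f.[x s']).
  apply: (cf [set u | V (h s u)]).
  by apply: (inverse_branch_cvg (hb s)); rewrite hE.
have h3 : \forall s' \near s, inverse_branch f f.[x s'] (h s).
  have ib := inverse_branch_near (hb s).
  exact: (cf _ ib).
near=> s' => _; apply: inverse_branch_unique; [exact: hx|exact: hb| |].
  by near: s'; exact: h3.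
rewrite hE; apply: (UV (x s', h s f.[x s'])).
  by split => /=; near: s'; [exact: h1|exact: h2].
have h3s : inverse_branch f f.[x s'] (h s) by near: s'; exact: h3.
by rewrite /= (inverse_branchE h3s).
Unshelve. all: by end_near. Qed.

Lemma linked_branch_at f (t0 : C) zi zj (p : C * C) :
  inverse_branch f t0 zi -> inverse_branch f t0 zj ->
  linked f (zi t0, zj t0) p ->
  exists wi wj, [/\ branch_at f t0 zi zj f.[p.1] wi wj,
    wi f.[p.1] = p.1 & wj f.[p.1] = p.2].
Proof.
move=> bi bj [x [y [cx cy [x0 y0] <- h]]] /=.
have fi0 : f.[x 0] = t0 by rewrite x0; exact: inverse_branchE.
have fj0 : f.[y 0] = t0 by rewrite y0; exact: inverse_branchE.
have hy s : ~ critical_values f f.[y s] by rewrite -(h s).1; exact: (h s).2.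
have [|||hi ci ei] := @lift_continuation f x zi cx; rewrite ?fi0 ?x0 //.
  by move=> s; exact: (h s).2.
have [|||hj cj ej] := @lift_continuation f y zj cy; rewrite ?fj0 ?y0 //.
have e : (fun s => f.[y s]) = (fun s => f.[x s]) by apply/funext => s; rewrite (h s).1.
exists (hi 1), (hj 1); split; [|exact: ei|by rewrite (h 1).1; exact: ej].
exists (fun s => f.[x s]), hi, hj.
split; [|exact: ci|by rewrite -e; exact: cj|reflexivity|reflexivity].
split; [|exact: fi0|reflexivity|by move=> s _; exact: (h s).2].
apply: continuous_subspaceT => s; apply: cvg_horner; exact: cx.
Qed.

(** The zeros of the integral, in terms of motions of pairs of points. *)
Lemma vanishing_setP f g (t0 : C) zi zj (t : C) : simple_cycle f t0 zi zj ->
  vanishing_set f g t0 zi zj t <->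
  exists x y : C, [/\ linked f (zi t0, zj t0) (x, y), f.[x] = t & g.[x] = g.[y]].
Proof.
move=> [bi bj _]; split.
  move=> [wi [wj [/branch_at_linked[lk ft] /eqP]]].
  rewrite /abelian_integral subr_eq0 => /eqP gE.
  by exists (wi t), (wj t).
move=> [x [y [lk <- gE]]].
have [wi [wj [br ei ej]]] := linked_branch_at bi bj lk.
exists wi, wj; split => //.
by rewrite /abelian_integral; rewrite /= in ei ej; rewrite ei ej gE subrr.
Qed.

Lemma real_complex_continuous : continuous (fun s : R => s%:C : C).
Proof.
move=> s; apply/cvgrPdist_lt => e e0.
have [er er0 eE] : exists2 r : R, 0 < r & e = r%:C.
  exists (complex.Re e); last by rewrite RRe_real // gtr0_real.
  by move: e0; rewrite ltcE /= => /andP[].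
rewrite eE.
have h : \forall u \near s, `|s - u| < er.
  exact: (@cvgr_dist_lt _ R^o _ (nbhs (s : R^o)) _ id s (@cvg_id _ _) er er0).
near=> u.
have -> : `|(s%:C : C) - u%:C| = `|s - u|%:C.
  rewrite -rmorphB /=; apply/eqP; rewrite normc_def /= expr0n addr0 sqrtr_sqr //.
by rewrite ltcR; near: u.
Unshelve. all: by end_near. Qed.

(** Linked pairs form a relatively open set: they can be moved along local
    branches. *)
Lemma linked_near f (p : C * C) (t : C) zi zj : f^`() != 0 ->
  inverse_branch f t zi -> inverse_branch f t zj ->
  ~ critical_values f t ->
  linked f p (zi t, zj t) -> \forall u \near t, linked f p (zi u, zj u).
Proof.
move=> df0 bi bj ht lk.
have H : \forall u \near t, [/\ inverse_branch f u zi, inverse_branch f u zj &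
    ~ critical_values f u].
  near=> u; split; near: u; [| |exact: regular_near]; exact: inverse_branch_near.
move: H => /nbhs_ballP[r /= r0 H].
near=> u.
have ub : ball t r u by near: u; exact: nbhsx_ballx.
apply: (linked_trans lk).
(* the segment from [t] to [u] stays in the ball where the branches exist *)
pose v s : C := t + (clamp s)%:C * (u - t).
have vb s : ball t r (v s).
  move: ub; rewrite /ball /= /v opprD addrA subrr sub0r normrN distrC => ub.
  apply: le_lt_trans ub; rewrite normrM ler_piMl //.
  have := clamp_itv s; rewrite in_itv /= => /andP[c0 c1].
  by rewrite ger0_norm ?ler0c // (lecR _ 1).
have cv : continuous v.
  move=> s; apply: cvgD; first exact: cvg_cst.
  apply: cvgM; last exact: cvg_cst.
  apply: (@continuous_comp _ _ _ clamp (fun s : R => s%:C : C)); first exact: clamp_continuous.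
  exact: real_complex_continuous.
have v0 : v 0 = t by rewrite /v clamp_le0 // mul0r addr0.
have v1 : v 1 = u by rewrite /v clamp_ge1 // mul1r addrC subrK.
exists (zi \o v), (zj \o v); split => /=.
- move=> s; apply: continuous_comp; first exact: cv.
  by have [h1 _ _] := H _ (vb s); exact: inverse_branch_cvg h1.
- move=> s; apply: continuous_comp; first exact: cv.
  by have [_ h2 _] := H _ (vb s); exact: inverse_branch_cvg h2.
- by rewrite v0.
- by rewrite v1.
- move=> s; have [h1 h2 h3] := H _ (vb s).
  by rewrite /= (inverse_branchE h1) (inverse_branchE h2).
Unshelve. all: by end_near. Qed.

End Vanishing.

(** * Growth at infinity *)

Section Modulus.
Context {R : realType}.
Implicit Types (z w : R[i]).

(** The modulus of a complex number, as a real number. *)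
Definition cabs z : R := complex.Re `|z|.

Lemma cabsE z : `|z| = (cabs z)%:C.
Proof. by rewrite /cabs RRe_real // normr_real. Qed.

Lemma cabs_ge0 z : 0 <= cabs z.
Proof. by rewrite -ler0c -cabsE. Qed.

Lemma cabs0 : cabs 0 = 0.
Proof. by rewrite /cabs normr0. Qed.

Lemma cabs1 : cabs 1 = 1.
Proof. by rewrite /cabs normr1. Qed.

Lemma cabs_eq0 z : (cabs z == 0) = (z == 0).
Proof. by rewrite -(inj_eq (@complexI R)) -cabsE normr_eq0. Qed.

Lemma cabs_gt0 z : (0 < cabs z) = (z != 0).
Proof. by rewrite lt_def cabs_ge0 cabs_eq0 andbT. Qed.

Lemma cabsM z w : cabs (z * w) = cabs z * cabs w.
Proof. by apply: complexI; rewrite rmorphM /= -!cabsE normrM. Qed.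

Lemma cabsX z k : cabs (z ^+ k) = cabs z ^+ k.
Proof. by apply: complexI; rewrite rmorphXn /= -!cabsE normrX. Qed.

Lemma cabsN z : cabs (- z) = cabs z.
Proof. by rewrite /cabs normrN. Qed.

Lemma cabsC z w : cabs (z - w) = cabs (w - z).
Proof. by rewrite /cabs distrC. Qed.

Lemma cabsD z w : cabs (z + w) <= cabs z + cabs w.
Proof. by rewrite -lecR rmorphD /= -!cabsE ler_normD. Qed.

Lemma cabsB z w : cabs (z - w) <= cabs z + cabs w.
Proof. by rewrite -(cabsN w); exact: cabsD. Qed.

Lemma cabs_prod I (r : seq I) (P : pred I) (F : I -> R[i]) :
  cabs (\prod_(i <- r | P i) F i) = \prod_(i <- r | P i) cabs (F i).
Proof. by apply: (big_morph cabs cabsM cabs1). Qed.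

Lemma cabs_sum I (r : seq I) (P : pred I) (F : I -> R[i]) :
  cabs (\sum_(i <- r | P i) F i) <= \sum_(i <- r | P i) cabs (F i).
Proof.
elim/big_ind2: _ => //; first by rewrite cabs0.
by move=> a b c d h1 h2; apply: le_trans (cabsD _ _) _; exact: lerD.
Qed.

Lemma cabs_real (a : R) : 0 <= a -> cabs a%:C = a.
Proof. by move=> a0; apply: complexI; rewrite -cabsE ger0_norm // ler0c. Qed.

Lemma cabs_dist3 x y z : cabs (x - z) <= cabs (x - y) + cabs (y - z).
Proof. by have -> : x - z = (x - y) + (y - z); [rewrite addrA subrK | exact: cabsD]. Qed.

End Modulus.

Section Growth.
Context {R : realType}.
Local Notation C := (R[i]).

(** A polynomial is its leading term up to a term of smaller order. *)
Lemma poly_tail_bound (p : {poly C}) : exists2 S : R, 0 <= S &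
  forall (mu : R) z, 1 <= mu -> cabs z <= mu ->
    cabs (p.[z] - lead_coef p * z ^+ (size p).-1) <= S * mu ^+ (size p).-2.
Proof.
exists (\sum_(i < (size p).-1) cabs p`_i).
  by apply: sumr_ge0 => i _; exact: cabs_ge0.
move=> mu z mu1 zmu; have mu0 : 0 <= mu by exact: le_trans mu1.
have [->|p0] := eqVneq p 0.
  rewrite horner0 lead_coef0 mul0r subrr cabs0 mulr_ge0 ?exprn_ge0 //.
  by apply: sumr_ge0 => i _; exact: cabs_ge0.
move: p0; rewrite -size_poly_gt0 horner_coef lead_coefE.
case: (size p) => [//|k] _ /=.
rewrite big_ord_recr /= addrK; apply: le_trans (cabs_sum _ _ _) _.
rewrite mulr_suml; apply: ler_sum => i _; rewrite cabsM cabsX.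
apply: ler_wpM2l; first exact: cabs_ge0.
apply: (@le_trans _ _ (mu ^+ i)).
  by apply: lerXn2r; rewrite ?nnegrE ?cabs_ge0 ?(le_trans ler01).
by apply: ler_weXn2l => //; case: k i => [[]//|k i] /=; rewrite -ltnS.
Qed.

(** A polynomial that is [O(t ^+ N)] at infinity has degree at most [N]. *)
Lemma size_le_growth (p : {poly C}) (B K : R) (N : nat) : 0 <= K ->
  (forall t, B <= cabs t -> cabs p.[t] <= K * cabs t ^+ N) -> (size p <= N.+1)%N.
Proof.
move=> K0 H; rewrite leqNgt; apply/negP => sp.
have p0 : p != 0 by rewrite -size_poly_gt0 (leq_ltn_trans _ sp).
have lp : 0 < cabs (lead_coef p) by rewrite cabs_gt0 lead_coef_eq0.
have [S S0 Sb] := poly_tail_bound p.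
set D := (size p).-2; have sD : (size p).-1 = D.+1.
  by rewrite /D; case: (size p) sp => [|[]].
have ND : (N <= D)%N by rewrite -ltnS -sD; case: (size p) sp.
pose T := Num.max 1 (Num.max B ((S + K) / cabs (lead_coef p) + 1)).
have T1 : 1 <= T by rewrite le_max lexx.
have TB : B <= T by rewrite !le_max lexx orbT.
have TC : (S + K) / cabs (lead_coef p) + 1 <= T by rewrite !le_max lexx !orbT.
have T0 : 0 < T by apply: lt_le_trans T1.
have cT : cabs (T%:C : C) = T by rewrite cabs_real // ltW.
have h1 := Sb T T%:C T1; rewrite cT lexx sD in h1; have {}h1 := h1 isT.
have h2 := H T%:C; rewrite cT in h2; have {}h2 := h2 TB.
have h3 : K * T ^+ N <= K * T ^+ D by apply: ler_wpM2l => //; exact: ler_weXn2l.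
have h4 : cabs (lead_coef p) * T ^+ D.+1 <= (S + K) * T ^+ D.
  have -> : cabs (lead_coef p) * T ^+ D.+1 = cabs (lead_coef p * T%:C ^+ D.+1).
    by rewrite cabsM cabsX cT.
  have := cabsD p.[T%:C] (lead_coef p * T%:C ^+ D.+1 - p.[T%:C]).
  rewrite addrC subrK cabsC => h5; apply: le_trans h5 _.
  by rewrite mulrDl addrC; apply: lerD => //; apply: le_trans h2 h3.
move: h4; rewrite exprS mulrA ler_pM2r ?exprn_gt0 // => h4.
have : (S + K) / cabs (lead_coef p) + 1 <= (S + K) / cabs (lead_coef p).
  by apply: le_trans TC _; rewrite ler_pdivlMr // mulrC.
by lra.
Qed.

Lemma prod_XaddC_coef_bound (s : seq C) r :
  cabs (\prod_(c <- s) ('X + c%:P))`_r <= \prod_(c <- s) (1 + cabs c).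
Proof.
elim: s r => [|c s IH] r.
  by rewrite !big_nil coefC; case: eqP => _; rewrite ?cabs1 ?cabs0.
rewrite !big_cons mulrDl coefD coefXM coefCM mulrDl mul1r.
apply: le_trans (cabsD _ _) _; apply: lerD.
  case: eqP => _; last exact: IH.
  by rewrite cabs0; apply: prodr_ge0 => d _; rewrite addr_ge0 ?cabs_ge0.
by rewrite cabsM; apply: ler_wpM2l; rewrite ?cabs_ge0.
Qed.

Lemma cabs_subXX (x y : C) (mu : R) k : cabs x <= mu -> cabs y <= mu ->
  cabs (x ^+ k - y ^+ k) <= cabs (x - y) * (k%:R * mu ^+ k.-1).
Proof.
move=> xm ym; rewrite subrXX cabsM; apply: ler_wpM2l; first exact: cabs_ge0.
apply: le_trans (cabs_sum _ _ _) _.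
have mu0 : 0 <= mu by apply: le_trans xm; exact: cabs_ge0.
rewrite -[X in X%:R * _](card_ord k) -sum1_card natr_sum mulr_suml.
apply: ler_sum => i _; rewrite mul1r cabsM !cabsX.
have -> : k.-1 = (k.-1 - i + i)%N.
  by rewrite subnK //; case: k i => [[]//|k i]; rewrite -ltnS.
rewrite exprD addnK; apply: ler_pM; rewrite ?exprn_ge0 ?cabs_ge0 //.
  by apply: lerXn2r; rewrite ?nnegrE ?cabs_ge0.
by apply: lerXn2r; rewrite ?nnegrE ?cabs_ge0.
Qed.

End Growth.
Lemma exists_prim_root (K : numClosedFieldType) n : (0 < n)%N ->
  exists w : K, n.-primitive_root w.
Proof.
move=> n0; have [rs rsE] := closed_field_poly_normal ('X^n - 1 : {poly K}).
have lc : lead_coef ('X^n - 1 : {poly K}) = 1 by rewrite lead_coefXnsubC.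
rewrite lc scale1r in rsE.
have urs : uniq rs.
  rewrite -separable_prod_XsubC -rsE; apply: separable_Xn_sub_1.
  by rewrite pnatr_eq0 -lt0n.
have srs : size rs = n.
  by apply: succn_inj; rewrite -(size_prod_XsubC rs id) -rsE size_XnsubC.
have : has n.-primitive_root rs.
  apply: has_prim_root => //; last by rewrite srs.
  by apply/allP => z zrs; rewrite /root_of_unity rsE root_prod_XsubC.
by case/hasP => w _ wp; exists w.
Qed.

Section RootAsymptotics.
Context {R : realType}.
Local Notation C := (R[i]).

(** Distinct [m]-th roots of unity are uniformly apart. *)
Lemma unity_gap m (w : C) : m.-primitive_root w ->
  exists2 del : R, 0 < del <= 1 & forall i j : 'I_m, i != j ->
    del <= cabs (w ^+ i - w ^+ j).
Proof.
move=> wp.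
exists (\big[Num.min/1]_(p : 'I_m * 'I_m | p.1 != p.2) cabs (w ^+ p.1 - w ^+ p.2)).
  rewrite bigmin_le_id andbT; apply/bigmin_gtP; split => // -[i j] /= ij.
  rewrite cabs_gt0 subr_eq0 (eq_prim_root_expr wp) !modn_small //.
move=> i j ij.
exact: (@bigmin_le_cond _ _ _ 1 (i, j) (fun p : 'I_m * 'I_m => p.1 != p.2)
  (fun p => cabs (w ^+ p.1 - w ^+ p.2))).
Qed.

Lemma prim_root_cabs m (w : C) i : m.-primitive_root w -> cabs (w ^+ i) = 1.
Proof.
move=> wp; have m0 := prim_order_gt0 wp.
have : cabs w ^+ m = 1 by rewrite -cabsX (prim_expr_order wp) cabs1.
move/eqP; rewrite pexpr_eq1 ?cabs_ge0 // => /eqP e.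
by rewrite cabsX e expr1n.
Qed.

Lemma unity_factor m (w tau z : C) : m.-primitive_root w ->
  z ^+ m - tau ^+ m = \prod_(j < m) (z - tau * w ^+ j).
Proof.
move=> wp; have m0 := prim_order_gt0 wp.
have [->|t0] := eqVneq tau 0.
  rewrite (eq_bigr (fun=> z)) => [|j _]; last by rewrite mul0r subr0.
  by rewrite prodr_const card_ord expr0n eqn0Ngt m0 subr0.
have e : ('X^m - 1 : {poly C}).[z / tau] = (z / tau) ^+ m - 1 by rewrite !hornerE.
have H : \prod_(j < m) (z / tau - w ^+ j) = (z / tau) ^+ m - 1.
  rewrite -e -(factor_Xn_sub_1 wp) big_mkord horner_prod.
  by apply: eq_bigr => j _; rewrite !hornerE.
have -> : z ^+ m - tau ^+ m = ((z / tau) ^+ m - 1) * tau ^+ m.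
  by rewrite mulrBl mul1r expr_div_n (divfK (expf_neq0 m t0)).
rewrite -H -[X in _ * tau ^+ X]card_ord -prodr_const -big_split /=.
apply: eq_bigr => j _.
by rewrite mulrBl divfK // (mulrC (w ^+ j)).
Qed.

(** For [t = lead_coef f * tau ^+ m] large, the roots of [f - t] are at bounded
    distance from the points [tau * w ^+ i], with [w] a primitive [m]-th root
    of unity. *)
Lemma roots_asymptotics (f : {poly C}) m (w : C) :
  size f = m.+1 -> m.-primitive_root w ->
  exists del K B : R, [/\ 0 < del, 0 <= K, 1 <= B & forall tau, B <= cabs tau ->
    exists zs : 'I_m -> C,
    [/\ f - (lead_coef f * tau ^+ m)%:P =
          lead_coef f *: \prod_i ('X - (zs i)%:P),
        forall i, cabs (zs i) <= 2 * cabs tau,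
        forall i : 'I_m, cabs (zs i - tau * w ^+ i) <= K &
        forall i j, i != j -> del * cabs tau <= cabs (zs i - zs j)]].
Proof.
move=> sf wp; have m0 := prim_order_gt0 wp.
have [del /andP[del0 del1] gap] := unity_gap wp.
have [S S0 Sb] := poly_tail_bound f; rewrite sf /= in Sb.
have a0 : 0 < cabs (lead_coef f).
  by rewrite cabs_gt0 lead_coef_eq0 -size_poly_eq0 sf.
set a := cabs (lead_coef f) in a0.
pose K := S * 2 ^+ m.-1 / (a * (del / 2) ^+ m.-1).
have d20 : 0 < del / 2 by lra.
have d40 : 0 < del / 4 by lra.
have K0 : 0 <= K.
  by rewrite divr_ge0 ?mulr_ge0 ?exprn_ge0 //; apply: ltW => //; rewrite ?exprn_gt0.
pose B := S / (a * (del / 4) ^+ m) + 1.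
have B1 : 1 <= B.
  rewrite ler_wpDl // divr_ge0 // mulr_ge0 ?exprn_ge0 // ltW //.
exists (del / 2), K, B; split => // tau tB.
set rho := cabs tau in tB *.
have rho1 : 1 <= rho by exact: le_trans tB.
have rho0 : 0 < rho by exact: lt_le_trans rho1.
pose x i := tau * w ^+ i.
have cx i : cabs (x i) = rho by rewrite /x cabsM (prim_root_cabs _ wp) mulr1.
have xgap (i j : 'I_m) : i != j -> del * rho <= cabs (x i - x j).
  move=> ij; rewrite /x -mulrBr cabsM mulrC; apply: ler_wpM2l (gap _ _ ij).
  exact: cabs_ge0.
have xm i : x i ^+ m = tau ^+ m.
  by rewrite /x exprMn -exprM mulnC exprM (prim_expr_order wp) expr1n mulr1.
set t := lead_coef f * tau ^+ m.
have sf1 : (1 < size f)%N by rewrite sf ltnS.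
have sft : size (f - t%:P) = m.+1 by rewrite size_subC.
have lft := lead_coef_subC t sf1.
(* [f - t] is small at [x i], which gives a root in the disc of radius
   [del / 4 * rho]; in that disc the other factors of [z ^+ m - tau ^+ m] are at
   least [del / 2 * rho], which improves the bound to a constant *)
have root_near (i : 'I_m) : exists z, [/\ f.[z] = t,
    cabs (x i - z) < del / 4 * rho, cabs z <= 2 * rho & cabs (z - x i) <= K].
  have [||z zr zle] := @near_root _ (f - t%:P) (x i).
  - by rewrite -size_poly_eq0 sft.
  - by rewrite sft.
  have fz : f.[z] = t by move: zr; rewrite /root !hornerE subr_eq0 => /eqP.
  have zc : cabs (x i - z) < del / 4 * rho.
    rewrite ltNge; apply/negP => far.
    have h1 : a * cabs (x i - z) ^+ m <= S * rho ^+ m.-1.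
      move: zle; rewrite sft lft !cabsE -rmorphXn -rmorphM lecR /= => h.
      apply: le_trans h _; rewrite !hornerE /t -(xm i).
      by apply: Sb => //; rewrite cx.
    have h2 : a * (del / 4 * rho) ^+ m <= a * cabs (x i - z) ^+ m.
      rewrite ler_pM2l //; apply: lerXn2r; rewrite ?nnegrE ?cabs_ge0 //.
      by rewrite mulr_ge0 // ltW.
    have := le_trans h2 h1.
    have -> : a * (del / 4 * rho) ^+ m = (a * (del / 4) ^+ m * rho) * rho ^+ m.-1.
      by rewrite [(del / 4 * rho) ^+ _]exprMn -[in rho ^+ m](prednK m0) exprS !mulrA.
    rewrite ler_pM2r ?exprn_gt0 // mulrC -ler_pdivlMr ?mulr_gt0 ?exprn_gt0 //.
    by move: tB; rewrite /B; lra.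
  have z2 : cabs z <= 2 * rho.
    have := cabs_dist3 z (x i) 0; rewrite !subr0 cx cabsC => h.
    apply: le_trans h _; move: zc.
    have : del / 4 * rho <= 1 * rho by rewrite ler_pM2r //; lra.
    by lra.
  exists z; split => //.
  have h1 : a * cabs (z ^+ m - tau ^+ m) <= S * (2 * rho) ^+ m.-1.
    rewrite /a -cabsM mulrBr -/t -fz cabsC; apply: Sb => //; lra.
  have h2 : cabs (z - x i) * (del / 2 * rho) ^+ m.-1 <= cabs (z ^+ m - tau ^+ m).
    rewrite (unity_factor _ _ wp) cabs_prod (bigD1 i) //= ler_wpM2l ?cabs_ge0 //.
    have card : #|predC1 i| = m.-1 by rewrite cardC1 card_ord.
    rewrite -[in X in X <= _]card -prodr_const /=.
    apply: ler_prod => j ji; rewrite mulr_ge0 /= ?(ltW d20) ?(ltW rho0) //.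
    have := cabs_dist3 (x i) z (x j); have := xgap i j; rewrite eq_sym => /(_ ji).
    by move: zc; rewrite /x; nra.
  have h3 : cabs (z - x i) * (a * (del / 2) ^+ m.-1) * rho ^+ m.-1 <=
      S * 2 ^+ m.-1 * rho ^+ m.-1.
    apply: le_trans (_ : _ <= a * cabs (z ^+ m - tau ^+ m)) _.
      have -> : cabs (z - x i) * (a * (del / 2) ^+ m.-1) * rho ^+ m.-1 =
          a * (cabs (z - x i) * (del / 2 * rho) ^+ m.-1).
        by rewrite [(del / 2 * rho) ^+ _]exprMn; ring.
      by rewrite ler_pM2l.
    by apply: le_trans h1 _; rewrite exprMn mulrA.
  by rewrite /K ler_pdivlMr ?mulr_gt0 ?exprn_gt0 //; move: h3; rewrite ler_pM2r ?exprn_gt0.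
have [zs zsP] := choice root_near.
have zgap i j : i != j -> del / 2 * rho <= cabs (zs i - zs j).
  move=> ij; have [_ hi _ _] := zsP i; have [_ hj _ _] := zsP j.
  have := xgap i j ij; have := cabs_dist3 (x i) (zs i) (x j).
  have := cabs_dist3 (zs i) (zs j) (x j); rewrite (cabsC (zs j)).
  by nra.
exists zs; split => //.
- apply: distinct_roots_factor => // [i j e|i]; last by have [] := zsP i.
  apply/eqP/negPn/negP => ij; have := zgap i j ij.
  by rewrite e subrr cabs0 leNgt mulr_gt0.
- by move=> i; have [] := zsP i.
- by move=> i; have [] := zsP i.
Qed.

End RootAsymptotics.
Section PairCount.
Local Open Scope nat_scope.

Lemma sum_sym_pairs m (F : 'I_m -> 'I_m -> nat) : (forall i j, F i j = F j i) ->
  \sum_i \sum_j F i j =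
  (\sum_(p : 'I_m * 'I_m | p.1 < p.2) F p.1 p.2).*2 + \sum_i F i i.
Proof.
move=> Fs; rewrite pair_big (bigID (fun p : 'I_m * 'I_m => p.1 < p.2)) /=.
rewrite [X in _ + X](bigID (fun p : 'I_m * 'I_m => p.2 < p.1)) /= addnA; congr (_ + _).
  rewrite -addnn; congr (_ + _).
  rewrite (reindex_inj (h := fun p : 'I_m * 'I_m => (p.2, p.1))) /=; last first.
    by move=> [a b] [c d] [-> ->].
  by apply: eq_big => [p|p _]; [case: ltngtP | rewrite Fs].
transitivity (\sum_i \sum_(j | j == i) F i j); last first.
  by apply: eq_bigr => i _; rewrite big_pred1_eq.
rewrite pair_big_dep /=; apply: eq_bigl => -[i j] /=.
by rewrite -!leqNgt -eqn_leq -val_eqE.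
Qed.

Lemma sum_residue m c d : 0 < m -> \sum_(0 <= j < d * m) (j %% m == c %% m) = d.
Proof.
move=> m0; elim: d => [|d IH]; first by rewrite mul0n big_geq.
rewrite mulSn addnC (big_cat_nat (n := d * m)) ?leq_addr //= IH -addn1; congr (_ + _).
rewrite -{1}[d * m]add0n big_addn addnC addnK big_mkord.
rewrite (bigD1 (Ordinal (ltn_pmod c m0))) //= [c %% m + _]addnC modnMDl !modn_mod eqxx.
rewrite big1 // => i ic; rewrite addnC modnMDl (modn_small (ltn_ord i)).
by move: ic; rewrite -val_eqE /= => /negbTE ->.
Qed.

(** Twice the number of unordered pairs of distinct [m]-th roots of unity, given
    by their exponents, with equal [n]-th powers. *)
Lemma card_low_pairs m n : 0 < m ->
  (\sum_(p : 'I_m * 'I_m | p.1 < p.2) (n * p.1 == n * p.2 %[mod m])).*2 =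
  m * (gcdn m n).-1.
Proof.
move=> m0; set d := gcdn m n.
have d0 : 0 < d by rewrite gcdn_gt0 m0.
pose m' := m %/ d; pose n' := n %/ d.
have mE : m = d * m' by rewrite mulnC divnK // dvdn_gcdl.
have nE : n = d * n' by rewrite mulnC divnK // dvdn_gcdr.
have m'0 : 0 < m' by move: m0; rewrite mE muln_gt0 => /andP[].
have cop : coprime m' n'.
  by rewrite /coprime -(eqn_pmul2l d0) muln_gcdr -mE -nE muln1.
(* the condition is congruence modulo [m / d] *)
have modE i j : (n * i == n * j %[mod m]) = (i == j %[mod m']).
  wlog ij : i j / i <= j.
    by move=> H; case: (leqP i j) => [/H//|/ltnW/H]; rewrite eq_sym [RHS]eq_sym.
  rewrite eq_sym [RHS]eq_sym !eqn_mod_dvd ?leq_mul2l ?ij ?orbT // -mulnBr.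
  by rewrite [in X in _ %| X]nE [X in X %| _]mE -mulnA dvdn_pmul2l // Gauss_dvdr.
have := sum_sym_pairs (m := m) (F := fun i j => (n * i == n * j %[mod m])) _.
move=> /(_ (fun i j => congr1 nat_of_bool (eq_sym _ _))) H.
have h1 : \sum_(i < m) \sum_(j < m) (n * i == n * j %[mod m]) = m * d.
  rewrite (eq_bigr (fun=> d)) ?sum_nat_const ?card_ord // => i _.
  rewrite -(big_mkord xpredT (fun j => nat_of_bool (n * i == n * j %[mod m]))).
  rewrite {1}mE -[RHS](sum_residue (i %% m') d m'0); apply: eq_bigr => j _.
  by rewrite modE eq_sym modn_mod.
have h2 : \sum_(i < m) (n * i == n * i %[mod m]) = m.
  by rewrite (eq_bigr (fun=> 1)) ?sum1_card ?card_ord // => i _; rewrite eqxx.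
rewrite h1 h2 in H; nia.
Qed.

Lemma card_pairs m : (\sum_(p : 'I_m * 'I_m | p.1 < p.2) 1).*2 = m * m.-1.
Proof.
have := sum_sym_pairs (m := m) (F := fun i j => 1) (fun _ _ => erefl).
have h1 : \sum_(i < m) \sum_(j < m) 1 = m * m.
  by rewrite (eq_bigr (fun=> m)) ?sum_nat_const ?card_ord // => i _; rewrite muln1.
have h2 : \sum_(i < m) 1 = m by rewrite sum1_card card_ord.
by rewrite h1 h2 => H; case: m {h1 h2} H => [|k]; nia.
Qed.

End PairCount.

Section DegreeBound.
Context {R : realType}.
Local Notation C := (R[i]).

(** The total exponent of growth of the divided differences, [n - 1] for each
    pair with one order less for the pairs counted by [card_low_pairs]. *)
Lemma exponent_sum m n N : (0 < m)%N -> (0 < n)%N ->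
  (N.*2 + (gcdn m n).-1 = n.-1 * m.-1)%N ->
  (\sum_(p : 'I_m * 'I_m | (p.1 < p.2)%N)
     (n.-1 - (n * p.1 == n * p.2 %[mod m])%N) = m * N)%N.
Proof.
move=> m0 n0 NE.
set L := (\sum_(p : 'I_m * 'I_m | (p.1 < p.2)%N) (n * p.1 == n * p.2 %[mod m]))%N.
have L2 : (L.*2 = m * (gcdn m n).-1)%N by exact: card_low_pairs.
set E := (\sum_(p | _) _)%N.
have EL : (E + L = (\sum_(p : 'I_m * 'I_m | (p.1 < p.2)%N) 1) * n.-1)%N.
  rewrite /E /L -big_split big_distrl /=; apply: eq_bigr => p lp; rewrite mul1n subnK //.
  case: n n0 {NE L2 E L} => [//|[|n]] _ /=; last by case: eqP.
  by rewrite !mul1n !modn_small // eqn_leq [(p.2 <= p.1)%N]leqNgt lp andbF.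
have := card_pairs m; move: EL; set M := (\sum_(p | _) _)%N; nia.
Qed.

(** Growth of the divided differences of [g] on the fibres of [f]: the pairs of
    roots that approach points with the same [n]-th power gain one order. *)
Lemma dq_growth (f g : {poly C}) m n (w : C) :
  size f = m.+1 -> size g = n.+1 -> (0 < n)%N -> m.-primitive_root w ->
  exists K B : R, [/\ 0 <= K, 1 <= B & forall tau, B <= cabs tau ->
    exists2 zs : 'I_m -> C,
      f - (lead_coef f * tau ^+ m)%:P =
          lead_coef f *: \prod_i ('X - (zs i)%:P) &
      forall i j, i != j ->
        1 + cabs (dq g (zs i) (zs j)) <=
        K * cabs tau ^+ (n.-1 - (n * i == n * j %[mod m])%N)].
Proof.
move=> sf sg n0 wp; have m0 := prim_order_gt0 wp.
have [del [K1 [B [del0 K10 B1 H]]]] := roots_asymptotics sf wp.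
have [S S0 Sb] := poly_tail_bound g; rewrite sg /= in Sb.
set b := cabs (lead_coef g).
have b0 : 0 <= b by exact: cabs_ge0.
(* [Kg] is the constant for all pairs, [Kl] for the pairs that gain one order *)
pose Kg := 2 * (b + S) * 2 ^+ n / del.
pose Kl := (b * (2 * K1 * (n%:R * 2 ^+ n.-1)) + 2 * S * 2 ^+ n.-1) / del.
have Kg0 : 0 <= Kg by rewrite divr_ge0 ?(ltW del0) // !mulr_ge0 ?addr_ge0 ?exprn_ge0.
have Kl0 : 0 <= Kl.
  by rewrite divr_ge0 ?(ltW del0) // addr_ge0 ?mulr_ge0 ?exprn_ge0.
exists (1 + Kg + Kl), B; split => //; first by rewrite !addr_ge0.
move=> tau tB; have [zs [fE z2 zK zgap]] := H _ tB.
exists zs => // i j ij.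
set rho := cabs tau in tB z2 zgap *.
have rho1 : 1 <= rho by exact: le_trans tB.
have rho0 : 0 < rho by exact: lt_le_trans rho1.
have r21 : 1 <= 2 * rho by lra.
have nS : n = n.-1.+1 by rewrite prednK.
set q := cabs (dq g (zs i) (zs j)).
have q0 : 0 <= q by exact: cabs_ge0.
have qE : q * (del * rho) <= cabs (g.[zs i] - g.[zs j]).
  by rewrite dqP cabsM mulrC ler_wpM2r // zgap.
have tail k : cabs (g.[zs k] - lead_coef g * zs k ^+ n) <= S * (2 * rho) ^+ n.-1.
  exact: Sb.
have tau2 k : cabs (tau * w ^+ k) <= 2 * rho.
  by rewrite cabsM (prim_root_cabs _ wp) mulr1 -/rho; lra.
have gk k : cabs g.[zs k] <= (b + S) * (2 * rho) ^+ n.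
  have -> : g.[zs k] = (g.[zs k] - lead_coef g * zs k ^+ n) + lead_coef g * zs k ^+ n.
    by rewrite subrK.
  apply: le_trans (cabsD _ _) _; rewrite mulrDl addrC; apply: lerD.
    rewrite cabsM cabsX; apply: ler_wpM2l => //.
    by apply: lerXn2r; rewrite ?nnegrE ?cabs_ge0 //; apply: le_trans r21.
  apply: le_trans (tail k) _; apply: ler_wpM2l => //; apply: ler_weXn2l => //.
  exact: leq_pred.
have generic : q <= Kg * rho ^+ n.-1.
  have h : q * (del * rho) <= 2 * ((b + S) * (2 * rho) ^+ n).
    apply: le_trans qE _; apply: le_trans (cabsB _ _) _.
    by have := gk i; have := gk j; lra.
  have e : 2 * ((b + S) * (2 * rho) ^+ n) = (Kg * rho ^+ n.-1) * (del * rho).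
    rewrite /Kg exprMn [in rho ^+ n]nS exprS; field.
    by rewrite gt_eqF.
  by rewrite e ler_pM2r // mulr_gt0 in h.
case: (boolP (n * i == n * j %[mod m])) => [low|_] /=; last first.
  rewrite subn0.
  have r1 : 1 <= rho ^+ n.-1 by rewrite exprn_ege1.
  have : 0 <= Kl * rho ^+ n.-1 by rewrite mulr_ge0 // exprn_ge0 // ltW.
  by lra.
have n1 : (1 < n)%N.
  rewrite ltn_neqAle n0 andbT; apply: contraL low => /eqP <-.
  by rewrite !mul1n !modn_small.
have wE : (tau * w ^+ i) ^+ n = (tau * w ^+ j) ^+ n.
  rewrite !exprMn -!exprM; congr (_ * _); apply/eqP.
  by rewrite (eq_prim_root_expr wp) ![(_ * n)%N]mulnC.
have zn k : cabs (zs k ^+ n - (tau * w ^+ k) ^+ n) <= K1 * (n%:R * (2 * rho) ^+ n.-1).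
  apply: le_trans (cabs_subXX n (z2 k) (tau2 k)) _; apply: ler_wpM2r => //.
  by rewrite mulr_ge0 // exprn_ge0 // (le_trans _ r21).
have lowq : q * (del * rho) <=
    b * (2 * K1 * (n%:R * (2 * rho) ^+ n.-1)) + 2 * S * (2 * rho) ^+ n.-1.
  apply: le_trans qE _.
  have -> : g.[zs i] - g.[zs j] =
      lead_coef g * ((zs i ^+ n - (tau * w ^+ i) ^+ n) -
                     (zs j ^+ n - (tau * w ^+ j) ^+ n))
      + ((g.[zs i] - lead_coef g * zs i ^+ n) - (g.[zs j] - lead_coef g * zs j ^+ n)).
    by rewrite wE; ring.
  apply: le_trans (cabsD _ _) _; apply: lerD.
    rewrite cabsM; apply: ler_wpM2l => //; apply: le_trans (cabsB _ _) _.
    by have := zn i; have := zn j; lra.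
  apply: le_trans (cabsB _ _) _.
  by have := tail i; have := tail j; lra.
have lowq2 : q <= Kl * rho ^+ (n.-1 - 1).
  have e : b * (2 * K1 * (n%:R * (2 * rho) ^+ n.-1)) + 2 * S * (2 * rho) ^+ n.-1 =
      (Kl * rho ^+ (n.-1 - 1)) * (del * rho).
    have nS2 : n.-1 = (n.-1 - 1).+1 by rewrite subn1 prednK // -ltnS prednK.
    rewrite /Kl !exprMn.
    have -> : rho ^+ n.-1 = rho * rho ^+ (n.-1 - 1) by rewrite {1}nS2 exprS.
    field.
    by rewrite gt_eqF.
  by rewrite e ler_pM2r // mulr_gt0 in lowq.
have r1 : 1 <= rho ^+ (n.-1 - 1) by rewrite exprn_ege1.
have : 0 <= Kg * rho ^+ (n.-1 - 1) by rewrite mulr_ge0 // exprn_ge0 // ltW.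
by lra.
Qed.

(** Every coefficient of the polynomial of [pair_product_coef] has degree at
    most [N] in [t]. *)
Lemma pair_product_degree (f g : {poly C}) m n N (K : nat -> {poly C}) :
  size f = m.+1 -> size g = n.+1 -> (0 < m)%N -> (0 < n)%N ->
  (N.*2 + (gcdn m n).-1 = n.-1 * m.-1)%N ->
  (forall t (zs : 'I_m -> C),
    f - t%:P = lead_coef f *: \prod_i ('X - (zs i)%:P) -> forall r,
    (K r).[t] = (\prod_(p : 'I_m * 'I_m | (p.1 < p.2)%N)
                  ('X + (dq g (zs p.1) (zs p.2))%:P))`_r) ->
  forall r, (size (K r) <= N.+1)%N.
Proof.
move=> sf sg m0 n0 NE HK r.
have [w wp] := exists_prim_root R[i] m0.
have [A [B [A0 B1 H]]] := dq_growth sf sg n0 wp.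
have a0 : 0 < cabs (lead_coef f).
  by rewrite cabs_gt0 lead_coef_eq0 -size_poly_eq0 sf.
set M := (\sum_(p : 'I_m * 'I_m | (p.1 < p.2)%N) 1)%N.
have B0 : 0 <= B by apply: le_trans B1.
apply: (@size_le_growth _ _ (cabs (lead_coef f) * B ^+ m) (A ^+ M / cabs (lead_coef f) ^+ N)).
  by rewrite divr_ge0 ?exprn_ge0 // ltW.
move=> t tB; pose tau := m.-root (t / lead_coef f).
have lf0 : lead_coef f != 0 by rewrite lead_coef_eq0 -size_poly_eq0 sf.
have tE : t = lead_coef f * tau ^+ m by rewrite rootCK // mulrC divfK.
have tauB : B <= cabs tau.
  rewrite -(@ler_pXn2r _ m) ?nnegrE ?cabs_ge0 // -(ler_pM2l a0).
  by rewrite -cabsX -cabsM -tE.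
have [zs fE q] := H _ tauB; rewrite -tE in fE.
rewrite (HK _ _ fE) -(big_filter _ _).
rewrite -(big_map (fun p : 'I_m * 'I_m => dq g (zs p.1) (zs p.2)) xpredT
  (fun c => 'X + c%:P)).
apply: le_trans (prod_XaddC_coef_bound _ _) _.
rewrite big_map big_filter.
apply: (@le_trans _ _ (\prod_(p : 'I_m * 'I_m | (p.1 < p.2)%N)
   (A * cabs tau ^+ (n.-1 - (n * p.1 == n * p.2 %[mod m])%N)))).
  apply: ler_prod => p lp; rewrite addr_ge0 ?cabs_ge0 //= q //.
  by rewrite -val_eqE neq_ltn lp.
rewrite big_split /= prodrXr (exponent_sum m0 n0 NE).
have -> : \prod_(p : 'I_m * 'I_m | (p.1 < p.2)%N) A = A ^+ M.
  by rewrite /M prodr_const sum1_card.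
rewrite -mulrA ler_wpM2l ?exprn_ge0 //.
have -> : cabs t = cabs (lead_coef f) * cabs tau ^+ m by rewrite tE cabsM cabsX.
by rewrite exprMn exprM mulKf // expf_neq0 // gt_eqF.
Qed.

End DegreeBound.

(** * The upper bound *)

Section UpperBound.
Context {R : realType}.
Local Notation C := (R[i]^o).
Implicit Types (f g : {poly R[i]}).

Lemma regular_roots f m (t : C) :
  (0 < m)%N -> size f = m.+1 -> ~ critical_values f t ->
  exists2 zs : 'I_m -> C, injective zs &
    f - (t : R[i])%:P = lead_coef f *: \prod_i ('X - (zs i : R[i])%:P).
Proof.
move=> m0 sf ht; have sf1 : (1 < size f)%N by rewrite sf ltnS.
have sft : size (f - (t : R[i])%:P) = m.+1 by rewrite size_subC.
have [|rs [urs srs rsE]] := simple_split sft.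
  move=> x; rewrite rootE !hornerE subr_eq0 => /eqP fx; rewrite derivB derivC subr0.
  by apply: regular_deriv; rewrite fx.
exists (fun i : 'I_m => nth 0 rs i).
  by move=> i j /eqP; rewrite nth_uniq ?srs // => /eqP/val_inj.
rewrite rsE lead_coef_subC //; congr (_ *: _).
by rewrite (big_nth 0) srs big_mkord.
Qed.

(** If the coefficients [K r], [r < k], of the polynomial of [pair_product_coef]
    vanish identically, then the isolated zeros are roots of the next one. *)
Lemma isolated_zero_root m f g (K : nat -> {poly R[i]}) k (t0 : C) zi zj (t : C) :
  (1 < m)%N -> size f = m.+1 ->
  (forall t (zs : 'I_m -> R[i]),
    f - t%:P = lead_coef f *: \prod_i ('X - (zs i)%:P) -> forall r,
    (K r).[t] = (\prod_(p : 'I_m * 'I_m | (p.1 < p.2)%N)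
                  ('X + (dq g (zs p.1) (zs p.2))%:P))`_r) ->
  (forall r, (r < k)%N -> K r = 0) ->
  simple_cycle f t0 zi zj -> ~ critical_values f t0 ->
  zeros f g t0 zi zj t -> root (K k) t.
Proof.
move=> m1 sf HK Klt cyc ht0 [/set_mem Vt [W nW WV]].
have m0 : (0 < m)%N by exact: ltnW.
have [x [y [lk fx gxy]]] := (vanishing_setP g t cyc).1 Vt.
have [_ _ zij] := cyc.
have xy : x != y := linked_neq lk zij.
have [fxy regx] := linked_eq_fibre lk; rewrite /= fx in fxy regx.
have df0 : f^`() != 0.
  have : f^`().[x] != 0 by apply: regular_deriv; rewrite fx.
  by apply: contraNneq => ->; rewrite horner0.
apply/negPn/negP => Kt.
have [zs zs_inj fE] := regular_roots m0 sf regx.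
have f0 : f != 0 by rewrite -size_poly_eq0 sf.
have fz z : f.[z] = t -> exists i, z = zs i by exact: factor_root fE f0.
have zf i : f.[zs i] = t by exact: factor_value fE.
have /choice[b bP] : forall i, exists b : C -> C, b t = zs i /\ inverse_branch f t b.
  move=> i; have := @local_inverse _ f (zs i); rewrite zf; apply.
  by apply: regular_deriv; rewrite zf.
pose P := [pred p : 'I_m * 'I_m | (p.1 < p.2)%N].
pose q (p : 'I_m * 'I_m) u : C := dq g (b p.1 u) (b p.2 u).
pose Z u := [set p in P | q p u == 0]%SET.
have inZ u p : (p \in Z u) = (p.1 < p.2)%N && (q p u == 0) by rewrite inE.
have bc i : b i @ t --> b i t by apply: inverse_branch_cvg; exact: (bP i).2.
have qc p : q p @ t --> q p t.
  exact: (@cvg_dq _ _ (nbhs t) _ g (b p.1) (b p.2) (b p.1 t) (b p.2 t) (bc _) (bc _)).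
have fb i : \forall u \near t, f.[b i u] = u.
  by have [_ h] := bP i; move: h; apply: filterS => u [].
have near_fE : \forall u \near t, f - (u : R[i])%:P =
    lead_coef f *: \prod_i ('X - (b i u : R[i])%:P).
  have h1 : \forall u \near t, forall i, f.[b i u] = u.
    exact: filter_forall fb.
  have h2' (p : 'I_m * 'I_m) : \forall u \near t, p.1 != p.2 -> b p.1 u - b p.2 u != 0.
    case: p => i j; case: (eqVneq i j) => [->|ij].
      by near=> u.
    have h : b i u - b j u @[u --> t] --> b i t - b j t.
      exact: (cvgB (bc i) (bc j)).
    have h3 : b i t - b j t != 0.
      by rewrite (bP i).1 (bP j).1 subr_eq0; apply: contraNneq ij => /zs_inj ->.
    have h4 : \forall u \near t, b i u - b j u != 0 := cvgr_neq0 _ h h3.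
    by near=> u => _; near: u; exact: h4.
  have h2 : \forall u \near t, forall p : 'I_m * 'I_m,
      p.1 != p.2 -> b p.1 u - b p.2 u != 0.
    exact: filter_forall h2'.
  near=> u.
  have h1u : forall i, f.[b i u] = u by near: u.
  have h2u : forall p : 'I_m * 'I_m, p.1 != p.2 -> b p.1 u - b p.2 u != 0 by near: u.
  apply: distinct_roots_factor => // i j /eqP; rewrite -subr_eq0 => e.
  by apply/eqP/negPn/negP => ij; have := h2u (i, j) ij; rewrite /= e.
(* every fibre has at least [k] vanishing pairs, and exactly [k] where the
   coefficient [K k] does not vanish *)
have cardZ u : f - (u : R[i])%:P = lead_coef f *: \prod_i ('X - (b i u : R[i])%:P) ->
   (k <= #|Z u|)%N /\ ((K k).[u] != 0 -> #|Z u| = k).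
  move=> fEu; have HKu := HK _ _ fEu.
  have prE : \prod_(p : 'I_m * 'I_m | (p.1 < p.2)%N)
       ('X + (dq g (b p.1 u) (b p.2 u))%:P) =
     \prod_(c <- [seq q p u : R[i] | p <- enum P]) ('X + c%:P) :> {poly R[i]}.
    by rewrite big_map big_enum.
  have cE : count (pred1 0%R) [seq q p u : R[i] | p <- enum P] = #|Z u|.
    rewrite count_map -sum1_count big_enum_cond -sum1_card.
    by apply: eq_bigl => p; rewrite !inE.
  have [lo1 lo2] := XaddC_prod_lowest [seq q p u : R[i] | p <- enum P].
  rewrite cE -prE in lo1 lo2.
  have kz : (k <= #|Z u|)%N.
    by rewrite leqNgt; apply: contra lo2 => zk; rewrite -HKu Klt // horner0.
  split => // Kku; apply/eqP; rewrite eqn_leq kz andbT leqNgt.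
  by apply: contra Kku => kz'; rewrite HKu lo1.
have bt i : b i t = zs i := (bP i).1.
have Zt : #|Z t| = k.
  apply: (cardZ t _).2; last by [].
  by rewrite fE; congr (_ *: _); apply: eq_bigr => i _; rewrite bt.
(* pairs that do not vanish at [t] do not vanish nearby either; by counting, the
   same [k] pairs vanish at all nearby points *)
have nearZ : \forall u \near t, Z u = Z t.
  have h1' p : \forall u \near t, p \notin Z t -> p \notin Z u.
    have [e|qp] := eqVneq (q p t) 0.
      near=> u; apply: contra; rewrite inZ => /andP[lp _].
      by rewrite inZ lp e eqxx.
    have h4 : \forall u \near t, q p u != 0 := cvgr_neq0 _ (qc p) qp.
    near=> u => _; rewrite inZ negb_and orbC; apply/orP; left.
    by near: u; exact: h4.
  have h1 : \forall u \near t, forall p, p \notin Z t -> p \notin Z u.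
    exact: filter_forall h1'.
  near=> u; apply/eqP; rewrite eqEcard; apply/andP; split.
    apply/fintype.subsetP => p; apply: contraTT; move: p; near: u; exact: h1.
  by rewrite Zt; apply: (cardZ u _).1; near: u.
have [i xi] := fz x fx; have [j yj] := fz y (esym fxy).
have ij : i != j by apply: contraNneq xy => e; rewrite xi yj e.
have vanish u : Z u = Z t -> g.[b i u] = g.[b j u].
  move=> ZE.
  have dxy : dq g x y = 0.
    have := dqP g x y; rewrite gxy subrr => /esym/eqP.
    by rewrite mulf_eq0 subr_eq0 (negbTE xy) /= => /eqP.
  have dij : dq g (b i u) (b j u) = 0.
    have [lij|lji] : (i < j)%N \/ (j < i)%N.
      by move: ij; rewrite -val_eqE neq_ltn => /orP[]; [left|right].
    - have : (i, j) \in Z t by rewrite !inE /= lij /q /= !bt -xi -yj dxy eqxx.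
      by rewrite -ZE !inE /= lij => /eqP.
    - have : (j, i) \in Z t by rewrite !inE /= lji /q /= !bt -xi -yj dq_sym dxy eqxx.
      by rewrite -ZE !inE /= lji /q /= dq_sym => /eqP.
  by apply/eqP; rewrite -subr_eq0 dqP dij mulr0.
have nearV : \forall u \near t, vanishing_set f g t0 zi zj u.
  have lk' : \forall u \near t, linked f (zi t0, zj t0) (b i u, b j u).
    apply: linked_near => //; [exact: (bP i).2|exact: (bP j).2|].
    by rewrite !bt -xi -yj.
  near=> u.
  apply/(vanishing_setP g u cyc); exists (b i u), (b j u); split.
  - by near: u; exact: lk'.
  - by near: u; exact: fb.
  - by apply: vanish; near: u; exact: nearZ.
have : nbhs t (W `&` vanishing_set f g t0 zi zj) by exact: filterI.
rewrite WV => /nbhs_ballP[e /= e0 /(_ (t + e / 2))] /=.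
have h : ball t e (t + e / 2).
  rewrite /ball /= opprD addrA subrr sub0r normrN ger0_norm; last by rewrite divr_ge0 // ltW.
  by rewrite ltr_pdivrMr // ltr_pMr // ltr1n.
move=> /(_ h) /eqP; rewrite -subr_eq0 addrAC subrr add0r mulf_eq0 invr_eq0.
by rewrite (pnatr_eq0 _ 2) orbF gt_eqF.
Unshelve. all: by end_near. Qed.

Lemma card_le_roots (p : {poly R[i]}) N (A : set C) :
  p != 0 -> (size p <= N.+1)%N -> (forall t, A t -> root p t) -> A #<= `I_N.
Proof.
move=> p0 sp Ap; have [rs pE] := closed_field_poly_normal p.
have srs : (size rs <= N)%N.
  rewrite -ltnS; apply: leq_trans sp.
  by rewrite [in X in (_ <= X)%N]pE size_scale ?lead_coef_eq0 // size_prod_XsubC.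
have sub : A `<=` (fun i => nth 0 rs i : C) @` `I_(size rs).
  move=> t /Ap; rewrite pE rootZ ?lead_coef_eq0 // root_prod_XsubC => trs.
  by exists (index t rs); rewrite /= ?index_mem // nth_index.
apply: card_le_trans (subset_card_le sub) _.
apply: card_le_trans (card_image_le _ _) _.
by rewrite card_le_II.
Qed.

Lemma zeros_card_le m n N f g (t0 : C) zi zj : (1 < m)%N -> (0 < n)%N ->
  (N.*2 + (gcdn m n).-1 = n.-1 * m.-1)%N ->
  admissible m n f g t0 zi zj -> zeros f g t0 zi zj #<= `I_N.
Proof.
move=> m1 n0 NE [sf sg ht0 cyc].
have m0 : (0 < m)%N by exact: ltnW.
have [K HK] := SymmetricFunctions.pair_product_coef g sf.
(* the polynomial is monic in the auxiliary variable, hence nonzero *)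
have exK : exists r, K r != 0.
  pose P := [pred p : 'I_m * 'I_m | (p.1 < p.2)%N].
  have [zs _ fE] := regular_roots m0 sf ht0.
  have := HK _ _ fE; rewrite -big_enum /=.
  rewrite -(big_map (fun p : 'I_m * 'I_m => dq g (zs p.1) (zs p.2)) xpredT
    (fun c => 'X + c%:P)).
  set s := map _ _ => H.
  have [_ h] := XaddC_prod_lowest s; exists (count (pred1 0%R) s).
  by apply: contraNneq h => K0; rewrite -H K0 horner0.
have [k Kk0 kmin] := ex_minnP exK.
have Klt r : (r < k)%N -> K r = 0.
  by move=> rk; apply/eqP; apply: contraLR rk => /kmin; rewrite -leqNgt.
apply: (card_le_roots Kk0).
  exact: (pair_product_degree sf sg m0 n0 NE HK).
by move=> t; exact: (isolated_zero_root m1 sf HK Klt cyc ht0).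
Qed.

End UpperBound.

(** * Pencils of polynomials *)

Lemma exists_notin (K : numDomainType) (s : seq K) : exists a : K, a \notin s.
Proof.
have [/hasP[a _ ha]|/hasPn h] :=
    boolP (has (fun a : K => a \notin s) [seq k%:R | k <- iota 0 (size s).+1]).
  by exists a.
have u : uniq [seq (k%:R : K) | k <- iota 0 (size s).+1].
  by rewrite map_inj_uniq ?iota_uniq // => i j /eqP; rewrite eqr_nat => /eqP.
have : (size [seq (k%:R : K) | k <- iota 0 (size s).+1] <= size s)%N.
  by apply: uniq_leq_size => // a /h; rewrite negbK.
by rewrite size_map size_iota ltnn.
Qed.

Section Pencil.
Context {K : numClosedFieldType}.
Implicit Types (A B p : {poly K}).

Lemma deriv_eq0_size p : p^`() = 0 -> (size p <= 1)%N.
Proof.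
move=> dp; rewrite leqNgt; apply/negP => sp.
have : p^`()`_(size p).-2 = 0 by rewrite dp coef0.
rewrite coef_deriv => /eqP; rewrite mulrn_eq0 /= prednK; last by case: (size p) sp => [|[]].
by rewrite -lead_coefE lead_coef_eq0 -size_poly_eq0; case: (size p) sp.
Qed.

(** A general member of a pencil [A + a * B] without base points has simple
    roots, which moreover avoid any given finite set. *)
Lemma generic_pencil A B bad D : A \is monic -> B \is monic ->
  size A = D.+1 -> size B = D.+1 -> (0 < D)%N ->
  (forall s, root A s -> ~~ root B s) -> bad != 0 ->
  exists a : K, exists rs : seq K, [/\ uniq rs, size rs = D,
    forall s, root (A + a *: B) s = (s \in rs) &
    forall s, s \in rs -> ~~ root bad s].
Proof.
move=> mA mB sA sB D0 cop bad0.
(* multiple roots of members of the pencil are roots of the Wronskian [W]; each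
   bad point lies on at most one member, and [-1] is excluded to keep the degree *)
pose W := A * B^`() - A^`() * B.
have W0 : W != 0.
  apply/negP; rewrite subr_eq0 => /eqP WE.
  have copAB : coprimep A B.
    by apply: Pdiv.ClosedField.root_coprimep => x /cop; rewrite rootE.
  have : A %| A^`() by rewrite -(Gauss_dvdpl _ copAB) -WE dvdp_mulr.
  have A'0 : A^`() != 0.
    by apply/eqP => /deriv_eq0_size; rewrite sA ltnS leqNgt D0.
  move=> /(dvdp_leq A'0); rewrite leqNgt lt_size_deriv // -size_poly_gt0 sA //.
have [bs bsE] := closed_field_poly_normal (bad * W).
have bsP s : root (bad * W) s = (s \in bs).
  by rewrite bsE rootZ ?root_prod_XsubC // lead_coef_eq0 mulf_neq0.
have [a] := exists_notin (-1 :: [seq - A.[s] / B.[s] | s <- bs]).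
rewrite inE negb_or => /andP[a1 abs].
have good s : root (A + a *: B) s -> s \notin bs.
  rewrite rootE !hornerE => /eqP e; apply: contra abs => sbs.
  have Bs : B.[s] != 0.
    apply/negP => /eqP Bs0; move: e; rewrite Bs0 mulr0 addr0 => As.
    by have := cop s; rewrite !rootE As Bs0 eqxx => /(_ isT).
  apply/mapP; exists s => //; apply: (canRL (mulfK Bs)).
  by apply/eqP; rewrite -subr_eq0 opprK addrC e.
have sP : size (A + a *: B) = D.+1.
  have : (A + a *: B)`_D != 0.
    rewrite coefD coefZ.
    have -> : A`_D = 1 by move/eqP: mA; rewrite lead_coefE sA.
    have -> : B`_D = 1 by move/eqP: mB; rewrite lead_coefE sB.
    by rewrite mulr1 addrC -[X in _ + X]opprK subr_eq0.
  move=> cD; apply/eqP; rewrite eqn_leq; apply/andP; split.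
    apply: leq_trans (size_polyD _ _) _; rewrite geq_max sA leqnn /=.
    by apply: leq_trans (size_scale_leq _ _) _; rewrite sB.
  by rewrite ltnNge; apply: contra cD => /leq_sizeP ->.
have [|rs [urs srs rsE]] := simple_split sP.
  move=> s rt; have := good s rt; rewrite -bsP rootM negb_or => /andP[_ Ws].
  apply: contra Ws; rewrite derivD derivZ !hornerE => /eqP e2.
  move: rt; rewrite !rootE !hornerE => /eqP e1.
  have -> : A.[s] = - (a * B.[s]) by apply/eqP; rewrite -addr_eq0 e1.
  have -> : A^`().[s] = - (a * B^`().[s]) by apply/eqP; rewrite -addr_eq0 e2.
  by apply/eqP; ring.
have rsP s : root (A + a *: B) s = (s \in rs).
  by rewrite rsE rootZ ?root_prod_XsubC // lead_coef_eq0 -size_poly_eq0 sP.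
exists a, rs; split => // s; rewrite -rsP => /good.
by rewrite -bsP rootM negb_or => /andP[].
Qed.

End Pencil.

Section QInteger.
Context {K : numClosedFieldType}.

(** The [q]-analogue [1 + 'X + ... + 'X^(k-1)] of the integer [k]. *)
Definition qint k : {poly K} := \sum_(i < k) 'X^i.

Lemma qintS k : qint k.+1 = qint k + 'X^k.
Proof. by rewrite /qint big_ord_recr. Qed.

Lemma qint_mulX k : ('X - 1) * qint k = 'X^k - 1.
Proof. by rewrite subrX1. Qed.

Lemma qint_horner k s : (s - 1) * (qint k).[s] = s ^+ k - 1.
Proof. by have := congr1 (horner^~ s) (qint_mulX k); rewrite !hornerE. Qed.

Lemma qint_at1 k : (qint k).[1] = k%:R.
Proof.
rewrite /qint horner_sum (eq_bigr (fun=> 1)) => [|i _]; last by rewrite hornerXn expr1n.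
by rewrite sumr_const card_ord.
Qed.

Lemma qint_at0 k : (0 < k)%N -> (qint k).[0] = 1.
Proof.
case: k => // k _; rewrite /qint horner_sum big_ord_recl hornerXn expr0 big1 ?addr0 // => i _.
by rewrite hornerXn /= expr0n.
Qed.

Lemma qint_monic_size k : (0 < k)%N -> qint k \is monic /\ size (qint k) = k.
Proof.
move=> k0; have Xm1 : 'X - 1 \is @monic K by rewrite -[1]/(1%:P) monicXsubC.
have m1 : ('X - 1) * qint k \is monic by rewrite qint_mulX monicXnsubC.
have mq : qint k \is monic by rewrite monicMl in m1.
split => //; have := size_monicM Xm1 (monic_neq0 mq).
by rewrite qint_mulX size_XnsubC // -[1]/(1%:P) size_XsubC => -[].
Qed.

Lemma qint_dvd d k : exists Q, qint (d * k) = qint d * Q.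
Proof.
exists (\sum_(i < k) ('X^d) ^+ i).
have X1 : ('X - 1 : {poly K}) != 0 by rewrite -[1]/(1%:P) polyXsubC_eq0.
by apply: (mulfI X1); rewrite qint_mulX mulrA qint_mulX -subrX1 exprM.
Qed.

Lemma root_qint k s : (0 < k)%N -> root (qint k) s -> s ^+ k = 1 /\ s != 1.
Proof.
move=> k0 /rootP r; split; first by apply/eqP; rewrite -subr_eq0 -qint_horner r mulr0.
by apply: contra_eqN r => /eqP ->; rewrite qint_at1 pnatr_eq0 -lt0n.
Qed.

Lemma qint_coprime k s : root (qint k.+1) s -> ~~ root (qint k) s.
Proof.
move=> r; have [sk _] := root_qint (ltn0Sn k) r.
apply/negP => /rootP r'; move: r; rewrite qintS rootE !hornerE r' add0r => /eqP e.
by move: sk; rewrite exprS e mulr0 => /eqP; rewrite eq_sym oner_eq0.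
Qed.

Lemma expr_gcd1 m n (s : K) :
  (0 < m)%N -> s ^+ m = 1 -> s ^+ n = 1 -> s ^+ gcdn m n = 1.
Proof.
move=> m0 sm sn; case: (egcdnP n m0) => km kn e _.
have : s ^+ (km * m) = 1 by rewrite mulnC exprM sm expr1n.
by rewrite e exprD mulnC exprM sn expr1n mul1r.
Qed.

(** The pencil cut out by the polynomials ['X^n + a *: 'X] on the curve of pairs
    of points with the same value of ['X^m - 'X^(m-1)], after division by the
    common factor [qint (gcdn m n)]. *)
Lemma pencil_factor m n N : (1 < m)%N -> (1 < n)%N ->
  (N.*2 + (gcdn m n).-1 = n.-1 * m.-1)%N ->
  exists A B : {poly K},
  [/\ qint (gcdn m n) * A = qint m.-1 ^+ n.-1 * qint n,
      qint (gcdn m n) * B = qint m ^+ n.-1,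
      A \is monic /\ B \is monic, size A = N.*2.+1 /\ size B = N.*2.+1 &
      forall s, root A s -> ~~ root B s].
Proof.
move=> m1 n1 NE; set d := gcdn m n.
have m0 : (0 < m)%N by exact: ltnW.
have n0 : (0 < n)%N by exact: ltnW.
have mp0 : (0 < m.-1)%N by rewrite -ltnS prednK.
have np0 : (0 < n.-1)%N by rewrite -ltnS prednK.
have d0 : (0 < d)%N by rewrite gcdn_gt0 m0.
have [Qm QmE] := qint_dvd d (m %/ d); rewrite mulnC divnK ?dvdn_gcdl // in QmE.
have [Qn QnE] := qint_dvd d (n %/ d); rewrite mulnC divnK ?dvdn_gcdr // in QnE.
have [md sd] := qint_monic_size d0.
have [mm sm] := qint_monic_size m0.
have [mn sn] := qint_monic_size n0.
have [mm1 sm1] := qint_monic_size mp0.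
exists (qint m.-1 ^+ n.-1 * Qn), (qint m ^+ n.-2 * Qm).
have EA : qint d * (qint m.-1 ^+ n.-1 * Qn) = qint m.-1 ^+ n.-1 * qint n.
  by rewrite QnE mulrCA.
have EB : qint d * (qint m ^+ n.-2 * Qm) = qint m ^+ n.-1.
  by rewrite mulrCA -QmE -exprSr prednK.
have mQn : Qn \is monic by rewrite QnE monicMl in mn.
have mQm : Qm \is monic by rewrite QmE monicMl in mm.
have mA : qint m.-1 ^+ n.-1 * Qn \is monic by rewrite monicMl ?monic_exp.
have mB : qint m ^+ n.-2 * Qm \is monic by rewrite monicMl ?monic_exp.
have size_exp (p : {poly K}) k : p \is monic -> size (p ^+ k) = ((size p).-1 * k).+1.
  move=> pm; have := size_exp p k; have : (0 < size (p ^+ k))%N.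
    by rewrite size_poly_gt0 monic_neq0 // monic_exp.
  by case: (size _) => // j _ /= ->.
split => //.
- split.
    have := size_monicM md (monic_neq0 mA).
    rewrite EA size_monicM ?monic_exp ?monic_neq0 // size_exp // sd sm1 sn.
    by move: NE; rewrite -/d; nia.
  have := size_monicM md (monic_neq0 mB).
  rewrite EB size_exp // sd sm.
  by move: NE; rewrite -/d; nia.
move=> s rA; apply/negP => rB.
have rm : root (qint m) s.
  have : root (qint d * (qint m ^+ n.-2 * Qm)) s by rewrite rootM rB orbT.
  by rewrite EB rootE horner_exp expf_eq0 => /andP[].
have [sm_1 s1] := root_qint m0 rm.
have rQn : root Qn s.
  move: rA; rewrite rootM => /orP[|//]; rewrite rootE horner_exp expf_eq0 => /andP[_ r1].
  rewrite -(prednK m0) in rm; by have := qint_coprime rm; rewrite rootE r1.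
have [sn_1 _] : s ^+ n = 1 /\ s != 1 by apply: root_qint => //; rewrite QnE rootM rQn orbT.
have rd : root (qint d) s.
  have := qint_horner d s; rewrite (expr_gcd1 m0 sm_1 sn_1) subrr => /eqP.
  by rewrite mulf_eq0 subr_eq0 (negbTE s1).
have : (('X - 1) * (qint d * Qn))^`().[s] = 0.
  by rewrite !derivM !(hornerD, hornerM) (rootP rQn) (rootP rd) !(mul0r, mulr0, addr0).
rewrite -QnE qint_mulX derivB derivXn derivC subr0 hornerMn hornerXn => /eqP.
rewrite mulrn_eq0 eqn0Ngt n0 /= expf_eq0 => /andP[_ /eqP s0].
by move: sn_1; rewrite s0 expr0n eqn0Ngt n0 => /eqP; rewrite eq_sym oner_eq0.
Qed.

End QInteger.

(** * A rational curve of pairs *)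

Section AvoidPath.
Context {R : realType}.
Local Notation C := (R[i]^o).

(** The complement of a finite set in the plane is path connected. *)
Lemma avoid_path (bad : {poly R[i]}) (s1 s2 : R[i]) : bad != 0 ->
  ~~ root bad s1 -> ~~ root bad s2 ->
  exists sigma : R -> C, [/\ continuous sigma, sigma 0 = s1, sigma 1 = s2 &
    forall tau, ~~ root bad (sigma tau)].
Proof.
move=> bad0 b1 b2; have [bs bsE] := closed_field_poly_normal bad.
have bsP s : root bad s = (s \in bs).
  by rewrite bsE rootZ ?root_prod_XsubC // lead_coef_eq0.
(* the path is a parabola arc [s1 + (s2 - s1) * (c +i* lam * c * (1 - c))] for
   [c] from [0] to [1]; each bad point rules out at most one value of [lam] *)
pose rel (s : R[i]) := (s - s1) / (s2 - s1).
have [lam lamP] := exists_notin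
  [seq complex.Im (rel s) / (complex.Re (rel s) * (1 - complex.Re (rel s)))
  | s <- bs].
pose P : {poly R[i]} := s1%:P + (s2 - s1) *: ('X + (0 +i* lam) *: ('X * (1 - 'X))).
have PE (c : R) : P.[c%:C] = s1 + (s2 - s1) * (c +i* (lam * (c * (1 - c)))).
  rewrite /P !hornerE; congr (_ + _ * _); apply/eqP.
  by rewrite eq_complex; simpc.
exists (fun tau => P.[(clamp tau)%:C]); split.
- move=> tau; apply: (@cvg_horner _ _ (nbhs tau) _ P (fun tau => (clamp tau)%:C)).
  apply: (@continuous_comp _ _ _ clamp (fun s : R => s%:C : C)); first exact: clamp_continuous.
  exact: real_complex_continuous.
- by rewrite clamp_le0 // PE mul0r mulr0 -[0 +i* 0]/(0 : R[i]) mulr0 addr0.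
- by rewrite clamp_ge1 // PE subrr !mulr0 -[1 +i* 0]/(1 : R[i]) mulr1 addrC subrK.
move=> tau; set c := clamp tau; rewrite PE.
have [e|ne] := eqVneq s2 s1; first by rewrite e subrr mul0r addr0.
have d0 : s2 - s1 != 0 by rewrite subr_eq0.
have [->|c0] := eqVneq c 0; first by rewrite mul0r mulr0 -[0 +i* 0]/(0 : R[i]) mulr0 addr0.
have [->|c1] := eqVneq c 1.
  by rewrite subrr !mulr0 -[1 +i* 0]/(1 : R[i]) mulr1 addrC subrK.
apply: contra lamP; rewrite bsP => h.
apply/mapP; exists (s1 + (s2 - s1) * (c +i* (lam * (c * (1 - c))))) => //.
have -> : rel (s1 + (s2 - s1) * (c +i* (lam * (c * (1 - c))))) =
    c +i* (lam * (c * (1 - c))).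
  by rewrite /rel addrAC subrr add0r mulrC mulKf.
rewrite /= mulfK // mulf_neq0 // subr_eq0 eq_sym //.
Qed.

End AvoidPath.

Section Curve.
Context {R : realType}.
Local Notation C := (R[i]).
Context (m : nat) (m1 : (1 < m)%N).

(** The first polynomial of the extremal example. *)
Definition fm : {poly C} := 'X^m - 'X^(m.-1).

(** The rational parametrization [s |-> (cx s, cy s)] of the curve of pairs of
    distinct points where [fm] takes the same value, completed by its limit
    points: a line [y = s * x] meets this curve at most once outside the origin.
    The values are meaningful where [qint m] does not vanish. *)
Definition cx (s : C) : C := (qint m.-1).[s] / (qint m).[s].
Definition cy (s : C) : C := s * cx s.

Let m0 : (0 < m)%N. Proof. exact: ltnW. Qed.
Let mp0 : (0 < m.-1)%N. Proof. by rewrite -ltnS prednK. Qed.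

Lemma size_fm : size fm = m.+1.
Proof. by rewrite /fm size_polyDl ?size_polyXn // size_polyN size_polyXn ltnS prednK. Qed.

Lemma fm_horner x : fm.[x] = x ^+ m.-1 * (x - 1).
Proof. by rewrite /fm !hornerE mulrBr mulr1 -exprSr prednK. Qed.

Lemma cx_eq s : (qint m).[s] != 0 -> cx s * (qint m).[s] = (qint m.-1).[s].
Proof. by move=> h; rewrite /cx divfK. Qed.

Lemma fm_diff (x s : C) :
  (s - 1) * (qint m).[s] * x - (s - 1) * (qint m.-1).[s] =
  (s ^+ m * x - s ^+ m.-1) - (x - 1).
Proof. by rewrite !qint_horner; ring. Qed.

Lemma curve_fibre s : (qint m).[s] != 0 -> fm.[cx s] = fm.[cy s].
Proof.
move=> h; apply/eqP; rewrite eq_sym -subr_eq0 !fm_horner /cy exprMn.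
have := fm_diff (cx s) s; rewrite -mulrA [_ * cx s]mulrC (cx_eq h) subrr => /esym e.
have -> : s ^+ m.-1 * cx s ^+ m.-1 * (s * cx s - 1) - cx s ^+ m.-1 * (cx s - 1) =
  cx s ^+ m.-1 * ((s * s ^+ m.-1 * cx s - s ^+ m.-1) - (cx s - 1)) by ring.
by rewrite -exprS prednK // e mulr0.
Qed.

(** Every pair of distinct points of a fibre, the first one being nonzero, is on
    the parametrized curve. *)
Lemma curve_param (x y : C) : x != 0 -> x != y -> fm.[x] = fm.[y] ->
  (qint m).[y / x] != 0 /\ x = cx (y / x) /\ y = cy (y / x).
Proof.
move=> x0 xy e; set s := y / x.
have yE : y = s * x by rewrite divfK.
have s1 : s - 1 != 0.
  by rewrite subr_eq0; apply: contraNneq xy => s1; rewrite yE s1 mul1r.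
have eq1 : x * (qint m).[s] = (qint m.-1).[s].
  apply: (mulfI s1); apply/eqP; rewrite -subr_eq0 mulrCA mulrC fm_diff.
  have := e; rewrite yE !fm_horner exprMn => /eqP.
  rewrite eq_sym -subr_eq0.
  have -> : s ^+ m.-1 * x ^+ m.-1 * (s * x - 1) - x ^+ m.-1 * (x - 1) =
     x ^+ m.-1 * ((s * s ^+ m.-1 * x - s ^+ m.-1) - (x - 1)) by ring.
  by rewrite -exprS prednK // mulf_eq0 expf_eq0 (negbTE x0) andbF.
have q0 : (qint m).[s] != 0.
  apply/negP => /eqP q0; have := @qint_coprime _ m.-1 s; rewrite prednK // !rootE q0 eqxx.
  by rewrite -eq1 q0 mulr0 eqxx => /(_ isT).
have xE : x = cx s by rewrite /cx -eq1 mulfK.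
by split => //; split => //; rewrite /cy -xE.
Qed.

(** Only finitely many parameters lie over critical values. *)
Lemma curve_critical : exists2 crit : {poly C}, crit != 0 & forall s,
  (qint m).[s] != 0 -> ~~ root crit s -> ~ critical_values fm fm.[cx s].
Proof.
have df0 : fm^`() != 0.
  by apply/eqP => /deriv_eq0_size; rewrite size_fm ltnS leqNgt m0.
have [sg sg0 sgP] := critical_values_poly df0.
have P0 : sg \Po fm != 0 by rewrite comp_poly_eq0 // size_fm ltnS.
have [rs rsE] := closed_field_poly_normal (sg \Po fm).
have rsP x : root (sg \Po fm) x = (x \in rs).
  by rewrite rsE rootZ ?root_prod_XsubC // lead_coef_eq0.
exists (\prod_(r <- rs) (qint m.-1 - r *: qint m)).
  rewrite prodf_seq_neq0; apply/allP => r _ /=; rewrite subr_eq0; apply/eqP => e.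
  have [_ sz] := qint_monic_size (K := R[i]) m0.
  have [mon sz1] := qint_monic_size (K := R[i]) mp0.
  have [r0|r0] := eqVneq r 0; first by move: (monic_neq0 mon); rewrite e r0 scale0r eqxx.
  by have := sz1; rewrite e size_scale // sz => /eqP; rewrite gtn_eqF // prednK.
move=> s q0; apply: contraNnot => /sgP rt.
have : cx s \in rs by rewrite -rsP rootE horner_comp.
move=> xrs; rewrite rootE horner_prod prodf_seq_eq0; apply/hasP; exists (cx s) => //=.
by rewrite !hornerE cx_eq // subrr.
Qed.

Lemma cx_cvg (s0 : R[i]^o) : (qint m).[s0] != 0 ->
  (cx : R[i]^o -> R[i]^o) @ s0 --> (cx s0 : R[i]^o).
Proof.
move=> h.
have cq k : (fun s : R[i]^o => (qint k).[s] : R[i]^o) @ s0 --> ((qint k).[s0] : R[i]^o).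
  by apply: (@cvg_horner _ _ (nbhs s0) _ (qint k) id s0); exact: cvg_id.
exact: (cvgM (cq m.-1) (cvgV h (cq m))).
Qed.

Lemma linked_curve (bad : {poly C}) s1 s2 : bad != 0 ->
  (forall s, ~~ root bad s -> (qint m).[s] != 0 /\ ~ critical_values fm fm.[cx s]) ->
  ~~ root bad s1 -> ~~ root bad s2 ->
  linked fm (cx s1, cy s1) (cx s2, cy s2).
Proof.
move=> bad0 badP b1 b2; have [sg [csg sg0 sg1 sgP]] := avoid_path bad0 b1 b2.
exists (fun t => cx (sg t)), (fun t => cy (sg t)); split.
- move=> t; apply: (@continuous_comp _ _ _ sg (cx : R[i]^o -> R[i]^o)); first exact: csg.
  by apply: cx_cvg; have [] := badP _ (sgP t).
- move=> t; apply: cvgM; first exact: csg.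
  apply: (@continuous_comp _ _ _ sg (cx : R[i]^o -> R[i]^o)); first exact: csg.
  by apply: cx_cvg; have [] := badP _ (sgP t).
- by rewrite sg0.
- by rewrite sg1.
- by move=> t; have [h1 h2] := badP _ (sgP t); split => //; exact: curve_fibre.
Qed.

End Curve.

(** * Separation of the pairs of a fibre *)

Section RationalFunctions.
Context {K : fieldType} (D : {poly K}).

(** Functions that agree, where [D] does not vanish, with a rational function
    whose denominator is a power of [D]. *)
Definition ratfn (F : K -> K) := exists (p : {poly K}) (e : nat),
  forall s, D.[s] != 0 -> F s * D.[s] ^+ e = p.[s].

Lemma ratfn_poly p : ratfn (fun s => p.[s]).
Proof. by exists p, 0%N => s _; rewrite mulr1. Qed.

Lemma ratfn_cst c : ratfn (fun=> c).
Proof. by exists c%:P, 0%N => s _; rewrite mulr1 hornerC. Qed.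

Lemma ratfn_div p : ratfn (fun s => p.[s] / D.[s]).
Proof. by exists p, 1%N => s Ds; rewrite divfK. Qed.

Lemma ratfnD F G : ratfn F -> ratfn G -> ratfn (fun s => F s + G s).
Proof.
move=> [p [e pE]] [q [k qE]]; exists (p * D ^+ k + q * D ^+ e), (e + k)%N => s Ds.
by rewrite !(hornerD, hornerM, horner_exp) -pE // -qE // exprD; ring.
Qed.

Lemma ratfnM F G : ratfn F -> ratfn G -> ratfn (fun s => F s * G s).
Proof.
move=> [p [e pE]] [q [k qE]]; exists (p * q), (e + k)%N => s Ds.
by rewrite hornerM -pE // -qE // exprD; ring.
Qed.

Lemma ratfnX F k : ratfn F -> ratfn (fun s => F s ^+ k).
Proof.
move=> FR; elim: k => [|k IH]; first exact: ratfn_cst.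
have [p [e pE]] := ratfnM FR IH; exists p, e => s Ds.
by rewrite exprS pE.
Qed.

Lemma ratfn_sum I (r : seq I) (P : pred I) (F : I -> K -> K) :
  (forall i, ratfn (F i)) -> ratfn (fun s => \sum_(i <- r | P i) F i s).
Proof.
move=> FR; elim: r => [|i r [p [e pE]]].
  by exists 0, 0%N => s _; rewrite big_nil mul0r horner0.
have [q [k qE]] := ratfnD (FR i) (ex_intro _ p (ex_intro _ e pE)).
case Pi: (P i); first by exists q, k => s Ds; rewrite big_cons Pi qE.
by exists p, e => s Ds; rewrite big_cons Pi pE.
Qed.

Lemma ratfn_horner q F : ratfn F -> ratfn (fun s => q.[F s]).
Proof.
move=> FR; have [p [e pE]] : ratfn (fun s => \sum_(i < size q) q`_i * F s ^+ i).
  by apply: ratfn_sum => i; apply: ratfnM; [exact: ratfn_cst|exact: ratfnX].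
by exists p, e => s Ds; rewrite horner_coef pE.
Qed.

(** A rational function that is nonzero somewhere is nonzero outside a finite
    set. *)
Lemma ratfn_neq0 F s0 : ratfn F -> D.[s0] != 0 -> F s0 != 0 ->
  exists2 p : {poly K}, p != 0 & forall s, D.[s] != 0 -> ~~ root p s -> F s != 0.
Proof.
move=> [p [e pE]] D0 F0; exists p.
  apply: contraNneq F0 => p0; have := pE _ D0; rewrite p0 horner0 => /eqP.
  by rewrite mulf_eq0 expf_eq0 (negbTE D0) andbF orbF.
by move=> s Ds; apply: contraNneq => F0s; rewrite rootE -pE // F0s mul0r.
Qed.

End RationalFunctions.

Section Separation.
Context {R : realType}.
Local Notation C := (R[i]^o).
Local Notation C4 := ((C * C) * (C * C))%type.
Local Notation base := (((1 : C), (0 : C)), ((0 : C), (0 : C))).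
Context (m n : nat) (m1 : (1 < m)%N) (n1 : (1 < n)%N).

Let m0 : (0 < m)%N. Proof. exact: ltnW. Qed.
Let mp0 : (0 < m.-1)%N. Proof. by rewrite -ltnS prednK. Qed.
Let fmC : {poly R[i]} := fm m.

Lemma near_nonroot (p : {poly R[i]}) (a : C) : p != 0 ->
  \forall s \near a, s != a -> ~~ root p s.
Proof.
move=> p0; have [rs rsE] := closed_field_poly_normal p.
have h (i : 'I_(size rs)) : \forall s \near a, s != a -> s != nth 0 rs i.
  have [->|ra] := eqVneq (nth 0 rs i) a; first by near=> s.
  have c : (fun s : C => s - nth 0 rs i : C) @ a --> (a - nth 0 rs i : C).
    exact: (@cvgB _ C _ (nbhs a) _ id (fun=> nth 0 rs i : C) _ _
      (@cvg_id _ _) (@cvg_cst _ _ _ _ _)).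
  have c0 : a - (nth 0 rs i : C) != 0 by rewrite subr_eq0 eq_sym.
  have h1 : \forall s \near a, s - (nth 0 rs i : C) != 0 := cvgr_neq0 _ c c0.
  near=> s => _; rewrite -subr_eq0; near: s; exact: h1.
have h2 : \forall s \near a, forall i : 'I_(size rs), s != a -> s != nth 0 rs i.
  exact: filter_forall h.
near=> s => sa; rewrite rsE rootZ ?lead_coef_eq0 // root_prod_XsubC.
have h3 : forall i : 'I_(size rs), s != a -> s != nth 0 rs i by near: s; exact: h2.
apply/negP => srs; have := h3 (Ordinal (_ : (index s rs < size rs)%N)) sa.
by rewrite /= index_mem => /(_ srs); rewrite nth_index // eqxx.
Unshelve. all: by end_near. Qed.

(* the divided difference in the second argument of that of ['X^n] *)
Let hq (x y w : R[i]) := \sum_(a < n) x ^+ (n.-1 - a) * dq 'X^a w y.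

Let hqP (x y w : R[i]) : dq 'X^n x w - dq 'X^n x y = (w - y) * hq x y w.
Proof.
rewrite !dqXn -sumrB mulr_sumr; apply: eq_bigr => a _.
by rewrite -mulrBr mulrCA -dqP !hornerXn.
Qed.

Let hq1 : hq 1 0 0 = 1.
Proof.
rewrite /hq (bigD1 (Ordinal n1)) //= expr1n mul1r dq_diag derivXn hornerMn.
rewrite hornerXn expr0 mulr1n.
rewrite big1 ?addr0 // => i i1; rewrite expr1n mul1r dq_diag derivXn hornerMn hornerXn.
case: i i1 => -[|[|k]] lk ne /=; first by rewrite mulr0n.
  by rewrite -val_eqE eqxx in ne.
by rewrite exprS mul0r mul0rn.
Qed.

(** For small [s], the pair [(cx s, cy s)] is determined among the pairs of its
    fibre by its divided difference of ['X^n]: one of its points is near [1],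
    and the other points of the fibre are near [0]. *)
Lemma separated_pair : exists s0 : R[i], [/\ (qint m).[s0] != 0,
  ~ critical_values fmC fmC.[cx m s0], cx m s0 != cy m s0 &
  forall z w, fmC.[z] = fmC.[cx m s0] -> fmC.[w] = fmC.[cx m s0] -> z != w ->
    dq 'X^n z w = dq 'X^n (cx m s0) (cy m s0) ->
    (z = cx m s0 /\ w = cy m s0) \/ (z = cy m s0 /\ w = cx m s0)].
Proof.
have f1 : fmC^`().[1] != 0.
  rewrite /fmC /fm derivB !derivXn hornerD hornerN !hornerMn !hornerXn !expr1n.
  by rewrite -natrB ?leq_pred // -subn1 subKn // oner_eq0.
(* [fm m] is injective near [1]; the second condition in [Pr] separates pairs
   near [(1, 0)] from pairs near [(0, 0)], the first one pairs near [(1, 0)] with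
   the same first point *)
have [r1 r10 inj1] := local_injectivity f1.
pose Pr (p : C4) :=
  hq p.1.1 p.1.2 p.2.2 != 0 /\
  dq ('X^n : {poly R[i]}) p.1.1 p.1.2 - dq ('X^n : {poly R[i]}) p.2.1 p.2.2 != 0.
have nPr : \forall p \near base, Pr p.
  have FF : Filter (nbhs base) by exact: nbhs_filter.
  have c11 : (fun p : C4 => p.1.1) @ base --> (1 : C).
    by apply: (@cvg_comp _ _ _ (fst : C4 -> C * C) fst); [exact: cvg_fst|exact: cvg_fst].
  have c12 : (fun p : C4 => p.1.2) @ base --> (0 : C).
    by apply: (@cvg_comp _ _ _ (fst : C4 -> C * C) snd); [exact: cvg_fst|exact: cvg_snd].
  have c21 : (fun p : C4 => p.2.1) @ base --> (0 : C).
    by apply: (@cvg_comp _ _ _ (snd : C4 -> C * C) fst); [exact: cvg_snd|exact: cvg_fst].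
  have c22 : (fun p : C4 => p.2.2) @ base --> (0 : C).
    by apply: (@cvg_comp _ _ _ (snd : C4 -> C * C) snd); [exact: cvg_snd|exact: cvg_snd].
  have d1 : (fun p : C4 => hq p.1.1 p.1.2 p.2.2 : C) @ base --> (hq 1 0 0 : C).
    have da (a : 'I_n) : (fun p : C4 =>
          p.1.1 ^+ (n.-1 - a) * dq ('X^a : {poly R[i]}) p.2.2 p.1.2 : C) @ base -->
        ((1 : C) ^+ (n.-1 - a) * dq ('X^a : {poly R[i]}) 0 0 : C).
      have pw' := @cvg_pow _ _ _ FF (n.-1 - a)%N _ _ c11.
      exact: (cvgM pw' (@cvg_dq _ _ _ FF 'X^a _ _ _ _ c22 c12)).
    exact: (cvg_bigsum (fun a _ => da a)).
  have d2 : (fun p : C4 => dq ('X^n : {poly R[i]}) p.1.1 p.1.2 -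
                           dq ('X^n : {poly R[i]}) p.2.1 p.2.2 : C) @ base -->
      (dq ('X^n : {poly R[i]}) 1 0 - dq ('X^n : {poly R[i]}) 0 0 : C).
    exact: (cvgB (@cvg_dq _ _ _ FF 'X^n _ _ _ _ c11 c12)
                 (@cvg_dq _ _ _ FF 'X^n _ _ _ _ c21 c22)).
  have n1' : (hq 1 0 0 : C) != 0 by rewrite hq1 oner_eq0.
  have n2' :
      (dq ('X^n : {poly R[i]}) 1 0 - dq ('X^n : {poly R[i]}) 0 0 : C) != 0.
    have -> : dq 'X^n (1 : R[i]) 0 = 1.
      have := dqP ('X^n) (1 : R[i]) 0; rewrite subr0 mul1r => <-.
      by rewrite !hornerXn expr1n expr0n eqn0Ngt ltnW //= subr0.
    have -> : dq 'X^n (0 : R[i]) 0 = 0.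
      have np : (n.-1 == 0)%N = false by move: n1; case: n => [|[]].
      by rewrite dq_diag derivXn hornerMn hornerXn expr0n np mul0rn.
    by rewrite subr0 oner_eq0.
  exact: (@filterI _ _ FF _ _ (@cvgr_neq0 _ _ _ _ FF _ _ d1 n1')
                              (@cvgr_neq0 _ _ _ _ FF _ _ d2 n2')).
case: nPr => -[A B] [/= [[A1 A2] /= [nA1 nA2] sA] [[B1 B2] /= [nB1 nB2] sB]] sAB.
have nU0 : nbhs (0 : C) (A2 `&` (B1 `&` B2)) by do 2?apply: filterI.
have [r2 /= r20 b2] := (nbhs_ballP _ _).1 nA1.
have [r3 /= r30 b3] := (nbhs_ballP _ _).1 nU0.
have [r [r0 [rr1 [rr2 rr3]]]] : exists r : R[i], 0 < r /\ r <= r1 /\ r <= r2 /\ r <= r3.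
  have min2 (a b : R[i]) : 0 < a -> 0 < b -> exists c : R[i], 0 < c /\ c <= a /\ c <= b.
    move=> a0 b0; have [h|h] := real_leP (gtr0_real a0) (gtr0_real b0); first by exists a.
    by exists b; rewrite (ltW h).
  have [c [c0 [c1 c2]]] := min2 _ _ r10 r20.
  have [e [e0 [e1 e2]]] := min2 _ _ c0 r30.
  by exists e; split => //; split; [exact: le_trans c1|split => //; exact: le_trans c2].
have PrP (x y z w : R[i]) : `|1 - x| < r -> `|0 - y| < r -> `|0 - z| < r -> `|0 - w| < r ->
    Pr ((x, y), (z, w)).
  move=> hx hy hz hw.
  have hx1 : A1 x by apply: b2; exact: lt_le_trans rr2.
  have [hy1 _] : (A2 `&` (B1 `&` B2)) y by apply: b3; exact: lt_le_trans rr3.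
  have [_ [hz1 _]] : (A2 `&` (B1 `&` B2)) z by apply: b3; exact: lt_le_trans rr3.
  have [_ [_ hw1]] : (A2 `&` (B1 `&` B2)) w by apply: b3; exact: lt_le_trans rr3.
  by apply: sAB; split => /=; [apply: (sA (x, y))|apply: (sB (z, w))].
have q0 k : (0 < k)%N -> (qint k).[0] = 1 :> R[i] by exact: qint_at0.
have x0E : cx m 0 = 1 :> R[i] by rewrite /cx !q0 // divr1.
have qm0 : (qint m).[0] != 0 :> R[i] by rewrite q0 // oner_eq0.
have xc : (cx m : C -> C) @ (0 : C) --> (1 : C).
  by rewrite -x0E; apply: cx_cvg.
have yc : (cy m : C -> C) @ (0 : C) --> (0 : C).
  have h : (cy m : C -> C) @ (0 : C) --> (0 * 1 : C).
    exact: (@cvgM R[i] C (nbhs (0 : C)) _ id (cx m) _ _ (@cvg_id _ _) xc).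
  by rewrite mul0r in h.
have fc : (fun s : C => fmC.[cx m s] : C) @ (0 : C) --> (0 : C).
  have f1E : fmC.[1] = 0 by rewrite /fmC (fm_horner m1) subrr mulr0.
  have h : (fun s : C => fmC.[cx m s] : C) @ (0 : C) --> (fmC.[1] : C).
    exact: (@cvg_horner _ _ (nbhs (0 : C)) _ fmC (cx m) 1 xc).
  by rewrite f1E in h.
have [crit crit0 critP] := curve_critical (R := R) m1.
have e1 : \forall s \near (0 : C), `|1 - cx m s| < r.
  exact: (@cvgr_dist_lt _ _ _ _ _ _ _ xc r r0).
have e2 : \forall s \near (0 : C), `|0 - cy m s| < r.
  exact: (@cvgr_dist_lt _ _ _ _ _ _ _ yc r r0).
have e3 : \forall s \near (0 : C), `|0 - fmC.[cx m s]| < r ^+ m.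
  exact: (@cvgr_dist_lt _ _ _ _ _ _ _ fc _ (exprn_gt0 m r0)).
have e4 : \forall s \near (0 : C), ((qint m).[s] : C) != 0.
  have c : (fun s : C => (qint m).[s] : C) @ (0 : C) --> ((qint m).[0] : C).
    by apply: (@cvg_horner _ _ (nbhs (0 : C)) _ (qint m) id); exact: cvg_id.
  exact: (cvgr_neq0 _ c qm0).
have e5 := near_nonroot 0 crit0.
have e6 : \forall s \near (0 : C), cx m s - cy m s != 0.
  have c : (fun s : C => cx m s - cy m s : C) @ (0 : C) --> (1 - 0 : C).
    exact: (@cvgB _ C _ (nbhs (0 : C)) _ _ _ _ _ xc yc).
  have h : (1 - 0 : C) != 0 by rewrite subr0 oner_eq0.
  exact: (cvgr_neq0 _ c h).
have [s [[s1 s2 s3] [s4 s5 s6] sn0]] : exists s : C, [/\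
    [/\ `|1 - cx m s| < r, `|0 - cy m s| < r & `|0 - fmC.[cx m s]| < r ^+ m],
    [/\ (qint m).[s] != 0, (s != 0 -> ~~ root crit s) & cx m s - cy m s != 0] & s != 0].
  have : \forall s \near (0 : C),
      [/\ `|1 - cx m s| < r, `|0 - cy m s| < r & `|0 - fmC.[cx m s]| < r ^+ m] /\
      [/\ (qint m).[s] != 0, (s != 0 -> ~~ root crit s) & cx m s - cy m s != 0].
    near=> s; split; split; near: s.
    - exact: e1.
    - exact: e2.
    - exact: e3.
    - exact: e4.
    - exact: e5.
    - exact: e6.
  move=> /nbhs_ballP[e /= e0 H].
  have he : ball (0 : C) e (e / 2).
    rewrite /ball /= sub0r normrN ger0_norm; last by rewrite divr_ge0 // ltW.
    by rewrite ltr_pdivrMr // ltr_pMr // ltr1n.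
  have [H1 H2] := H _ he; exists (e / 2); split => //.
  by rewrite mulf_neq0 ?invr_eq0 ?pnatr_eq0 // gt_eqF.
exists s; split => //.
- by apply: critP => //; exact: s5.
- by rewrite -subr_eq0.
(* the value [f(cx s)] is so small that each of its preimages is near [0] or [1] *)
have dich z : fmC.[z] = fmC.[cx m s] -> z = cx m s \/ `|0 - z| < r.
  move=> fz; have [h|h] := real_ltP (normr_real (0 - z)) (gtr0_real r0); first by right.
  left; have hz : `|1 - z| < r.
    rewrite real_ltNge ?normr_real ?gtr0_real //; apply/negP => h'.
    move: s3; rewrite -fz /fmC (fm_horner m1) sub0r normrN normrM normrX => /lt_geF.
    rewrite -(prednK m0) exprSr ler_pM ?exprn_ge0 ?(ltW r0) //.
      by rewrite lerXn2r ?nnegrE ?(ltW r0) //; move: h; rewrite sub0r normrN.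
    by rewrite distrC.
  have d : dq fmC z (cx m s) != 0.
    by apply: inj1; rewrite /ball /=; exact: lt_le_trans rr1.
  have := dqP fmC z (cx m s); rewrite fz subrr => /esym/eqP.
  by rewrite mulf_eq0 (negbTE d) orbF subr_eq0 => /eqP.
have key w : `|0 - w| < r -> dq 'X^n (cx m s) w = dq 'X^n (cx m s) (cy m s) -> w = cy m s.
  move=> hw e; have [/= h0 _] := PrP _ _ _ _ s1 s2 hw hw.
  have := hqP (cx m s) (cy m s) w; rewrite e subrr => /esym/eqP.
  by rewrite mulf_eq0 (negbTE h0) orbF subr_eq0 => /eqP.
move=> z w /dich[-> | hz] /dich[-> | hw] zw e.
- by rewrite eqxx in zw.
- by left; split; [|exact: key].
- by right; split; [apply: key hz _; rewrite dq_sym|].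
- have [_ /=] := PrP _ _ _ _ s1 s2 hz hw.
  by rewrite e subrr eqxx.
Unshelve. all: by end_near. Qed.

End Separation.
Lemma pair_index (T : eqType) m (zs : 'I_m -> T) (i j : 'I_m) : i != j ->
  exists2 p : 'I_m * 'I_m, (p.1 < p.2)%N &
    p = (i, j) \/ p = (j, i).
Proof.
rewrite -val_eqE neq_ltn => /orP[h|h]; first by exists (i, j) => //; left.
by exists (j, i) => //; right.
Qed.

Section LowerBound.
Context {R : realType}.
Local Notation C := (R[i]^o).
Context (m n : nat) (m1 : (1 < m)%N) (n1 : (1 < n)%N).
Local Notation f := (fm m : {poly R[i]}).
Local Notation x := (@cx R m).
Local Notation y := (@cy R m).

Let m0 : (0 < m)%N. Proof. exact: ltnW. Qed.
Let szf : size f = m.+1. Proof. exact: size_fm. Qed.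

(* the polynomial of [pair_product_coef] for ['X^n] *)
Let kp (zs : 'I_m -> R[i]) : {poly R[i]} :=
  \prod_(p : 'I_m * 'I_m | (p.1 < p.2)%N) ('X + (dq 'X^n (zs p.1) (zs p.2))%:P).

Lemma ratfn_dq : ratfn (qint m) (fun s => dq 'X^n (x s) (y s)).
Proof.
have rx : ratfn (qint m) x by exact: ratfn_div.
have ry : ratfn (qint m) y.
  apply: ratfnM => //; have [p [e pE]] := ratfn_poly (qint m) ('X : {poly R[i]}).
  by exists p, e => s Ds; rewrite -pE // hornerX.
have [p [e pE]] : ratfn (qint m) (fun s => \sum_(a < n) x s ^+ (n.-1 - a) * y s ^+ a).
  by apply: ratfn_sum => a; apply: ratfnM; exact: ratfnX.
by exists p, e => s Ds; rewrite dqXn pE.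
Qed.

(** Apart from finitely many [s], the pair [(cx s, cy s)] gives a simple root of
    the polynomial formed from the divided differences of ['X^n] on the pairs of
    its fibre. *)
Lemma separating_poly : exists2 gam : {poly R[i]}, gam != 0 & forall s,
  (qint m).[s] != 0 -> ~~ root gam s -> forall zs : 'I_m -> R[i],
  f - f.[x s]%:P = lead_coef f *: \prod_i ('X - (zs i)%:P) ->
  (kp zs)^`().[- dq 'X^n (x s) (y s)] != 0.
Proof.
have [K HK] := SymmetricFunctions.pair_product_coef 'X^n szf.
pose P := [pred p : 'I_m * 'I_m | (p.1 < p.2)%N].
pose G s := \sum_(r < #|P|.+1) (K r.+1 *+ r.+1).[f.[x s]] * (- dq 'X^n (x s) (y s)) ^+ r.
have GE s zs : f - f.[x s]%:P = lead_coef f *: \prod_i ('X - (zs i)%:P) ->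
    (kp zs)^`().[- dq 'X^n (x s) (y s)] = G s.
  move=> fE; have szk : (size (kp zs)^`() <= #|P|.+1)%N.
    apply: leq_trans (size_poly _ _) _; apply: leq_trans (leq_pred _) _.
    rewrite /kp (eq_bigl (mem P)) // -big_enum /=.
    rewrite (eq_bigr (fun p => 'X - (- dq 'X^n (zs p.1) (zs p.2))%:P)); last first.
      by move=> p _; rewrite polyCN opprK.
    by rewrite (size_prod_XsubC (enum P) (fun p => - dq 'X^n (zs p.1) (zs p.2)))
      -cardE.
  rewrite (horner_coef_wide _ szk); apply: eq_bigr => r _; congr (_ * _).
  by rewrite coef_deriv -(HK _ _ fE) hornerMn.
have rG : ratfn (qint m) G.
  have rx : ratfn (qint m) x by exact: ratfn_div.
  apply: ratfn_sum => r; apply: ratfnM.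
    have [p [e pE]] := ratfn_horner ((K r.+1 *+ r.+1) \Po f) rx.
    by exists p, e => s Ds; rewrite -pE // horner_comp.
  apply: ratfnX; have [p [e pE]] := ratfnM (ratfn_cst (qint m) (-1)) ratfn_dq.
  by exists p, e => s Ds; rewrite -pE // mulN1r.
have [s0 [D0 reg xy sep]] := separated_pair (R := R) m1 n1.
have [zs zi fE] := regular_roots m0 szf reg.
have f0 : f != 0 by rewrite -size_poly_eq0 szf.
have [i xE] := factor_root fE f0 (erefl f.[x s0]).
have [j yE] := factor_root fE f0 (esym (curve_fibre m1 D0)).
have ij : i != j by apply: contraNneq xy => e; rewrite xE yE e.
have G0 : G s0 != 0.
  rewrite -(GE _ _ fE).
  have [p0 lp0 p0E] := pair_index zs ij.
  have c0 : dq 'X^n (zs p0.1) (zs p0.2) = dq 'X^n (x s0) (y s0).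
    by case: p0E => ->; rewrite /= -xE -yE // dq_sym.
  rewrite -c0 /kp.
  apply: (@deriv_prod_XaddC _ _ (fun p : 'I_m * 'I_m => (p.1 < p.2)%N)
    (fun p => dq 'X^n (zs p.1) (zs p.2)) p0) => // p lp pp0.
  apply: contraNneq pp0; rewrite c0 => e.
  have zz : zs p.1 != zs p.2.
    by rewrite (inj_eq zi) -val_eqE neq_ltn lp.
  have := sep _ _ (factor_value p.1 fE) (factor_value p.2 fE) zz e.
  rewrite xE yE => H; apply/eqP; case: p lp {e zz} H => p1 p2 /= lp.
  by case=> -[/zi h1 /zi h2]; move: p0E lp0 lp; rewrite h1 h2 => -[] -> //= h3 h4;
    have := ltn_trans h3 h4; rewrite ltnn.
have [gam gam0 gamP] := ratfn_neq0 rG D0 G0.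
by exists gam => // s Ds rs ws fE'; rewrite (GE _ _ fE'); exact: gamP.
Qed.

(** Two parameters with the same value of [f] and the same divided difference are
    equal or inverse to each other. *)
Lemma same_fibre (gam : {poly R[i]}) s s' (a : R[i]) :
  (forall s, (qint m).[s] != 0 -> ~~ root gam s -> forall zs : 'I_m -> R[i],
    f - f.[x s]%:P = lead_coef f *: \prod_i ('X - (zs i)%:P) ->
    (kp zs)^`().[- dq 'X^n (x s) (y s)] != 0) ->
  (qint m).[s] != 0 -> (qint m).[s'] != 0 -> x s != 0 -> x s' != 0 ->
  x s != y s -> x s' != y s' -> ~~ root gam s -> ~ critical_values f f.[x s] ->
  dq 'X^n (x s) (y s) = a -> dq 'X^n (x s') (y s') = a ->
  f.[x s'] = f.[x s] -> s' = s \/ s' = s^-1.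
Proof.
move=> gamP D D' xs0 xs0' xy xy' gs reg qa qa' ff.
have [zs zi fE] := regular_roots m0 szf reg.
have f0 : f != 0 by rewrite -size_poly_eq0 szf.
have [i xE] := factor_root fE f0 (erefl f.[x s]).
have [j yE] := factor_root fE f0 (esym (curve_fibre m1 D)).
have [i' xE'] := factor_root fE f0 ff.
have [j' yE'] : exists j', y s' = zs j'.
  by apply: (factor_root fE f0); rewrite -(curve_fibre m1 D').
have ij : i != j by apply: contraNneq xy => e; rewrite xE yE e.
have ij' : i' != j' by apply: contraNneq xy' => e; rewrite xE' yE' e.
have [p lp pE] := pair_index zs ij; have [p' lp' pE'] := pair_index zs ij'.
pose c (q : 'I_m * 'I_m) := dq 'X^n (zs q.1) (zs q.2).
have cp : c p = a.
  by case: pE => ->; rewrite /c /= -xE -yE; [exact: qa|rewrite dq_sym; exact: qa].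
have cp' : c p' = a.
  by case: pE' => ->; rewrite /c /= -xE' -yE'; [exact: qa'|rewrite dq_sym; exact: qa'].
have pp : p = p'.
  apply/eqP/negPn/negP => ne; have := gamP s D gs zs fE; rewrite qa -cp.
  have k0 : (kp zs)^`().[- c p] = 0.
    exact: (@deriv_prod_XaddC_double _ _ (fun q : 'I_m * 'I_m => (q.1 < q.2)%N)
      c p p' lp lp' ne (etrans cp (esym cp'))).
  by rewrite k0 eqxx.
have sE : s = y s / x s by rewrite /cy mulfK.
have sE' : s' = y s' / x s' by rewrite /cy mulfK.
rewrite pp in pE.
have [[xx yy]|[xx yy]] :
    (x s' = x s /\ y s' = y s) \/ (x s' = y s /\ y s' = x s).
  rewrite xE yE xE' yE'.
  case: pE => pe; case: pE' => pe'; move: pe'; rewrite pe => -[-> ->].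
  - by left.
  - by right.
  - by right.
  - by left.
- by left; rewrite sE' sE xx yy.
- by right; rewrite sE' [in RHS]sE xx yy invf_div.
Qed.

End LowerBound.

(** * The bound is attained *)

Lemma size_undup_two_to_one (T U : eqType) (h : T -> U) (iota : T -> T) (rs : seq T) N :
  uniq rs -> size rs = N.*2 ->
  (forall s s', s \in rs -> s' \in rs -> h s' = h s -> s' = s \/ s' = iota s) ->
  (N <= size (undup [seq h s | s <- rs]))%N.
Proof.
case: rs => [|s0 rs0]; first by case: N.
set rs := s0 :: rs0 => urs srs H.
pose sec t := nth s0 rs (index t [seq h s | s <- rs]).
have : (size rs <= size (flatten [seq [:: sec t; iota (sec t)]
                                 | t <- undup [seq h s | s <- rs]]))%N.
  apply: uniq_leq_size => // s srs'.
  have hs : h s \in [seq h s | s <- rs] by exact: map_f.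
  have idx : (index (h s) [seq h s | s <- rs] < size rs)%N.
    by rewrite -(size_map h) index_mem.
  have hsec : h (sec (h s)) = h s by rewrite -(nth_map _ (h s0)) // nth_index.
  apply/flattenP; exists [:: sec (h s); iota (sec (h s))].
    by apply/mapP; exists (h s) => //; rewrite mem_undup.
  have secrs : sec (h s) \in rs by exact: mem_nth.
  have [e|e] := H (sec (h s)) s secrs srs' (esym hsec).
    by rewrite [in X in X \in _]e !inE eqxx.
  by rewrite [in X in X \in _]e !inE eqxx orbT.
have fl (l : seq U) : size (flatten [seq [:: sec t; iota (sec t)] | t <- l]) = (size l).*2.
  by elim: l => //= t l ->; rewrite doubleS.
by rewrite fl srs leq_double.
Qed.

Section Attained.
Context {R : realType}.
Local Notation C := (R[i]^o).

(** All points of a finite set are isolated. *)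
Lemma finite_isolated (V : set C) (ts : seq C) :
  (forall t, V t -> t \in ts) -> V `<=` isolated V.
Proof.
move=> Vts t Vt; split; first exact/mem_set.
have [p p0 pP] : exists2 p : {poly R[i]}, p != 0 & forall u : C, u \in ts -> root p u.
  exists (\prod_(u <- ts) ('X - (u : R[i])%:P)).
    by rewrite prodf_seq_neq0; apply/allP => u _; rewrite polyXsubC_eq0.
  by move=> u uts; rewrite root_prod_XsubC.
exists [set s | s != t -> ~~ root p s]; first exact: near_nonroot.
apply/seteqP; split=> [s [/= h Vs]|s /= ->]; last by split => //=; rewrite eqxx.
by apply/eqP/negPn/negP => st; have := h st; rewrite pP //; exact: Vts.
Qed.

(** In the main case the extremal example is [fm m] with ['X^n + a *: 'X], for a
    general [a]. *)
Lemma attained_pos m n N : (1 < m)%N -> (1 < n)%N -> (0 < N)%N ->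
  (N.*2 + (gcdn m n).-1 = n.-1 * m.-1)%N ->
  exists (f g : {poly R[i]}) (t0 : C) (zi zj : C -> C),
    admissible m n f g t0 zi zj /\ zeros f g t0 zi zj #= `I_N.
Proof.
move=> m1 n1 N0 NE.
have m0 : (0 < m)%N by exact: ltnW.
have n0 : (0 < n)%N by exact: ltnW.
have mp0 : (0 < m.-1)%N by rewrite -ltnS prednK.
have [A [B [EA EB [mA mB] [sA sB] cop]]] := @pencil_factor R[i] m n N m1 n1 NE.
have [crit crit0 critP] := curve_critical (R := R) m1.
have [gam gam0 gamP] := separating_poly (R := R) m1 n1.
pose bad : {poly R[i]} := qint m * qint m.-1 * ('X - 1%:P) * crit * gam.
have bad0 : bad != 0.
  have [qm _] := @qint_monic_size R[i] m m0.
  have [qm1 _] := @qint_monic_size R[i] m.-1 mp0.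
  have Xm1 : ('X - 1%:P : {poly R[i]}) != 0 by rewrite polyXsubC_eq0.
  have q12 := mulf_neq0 (monic_neq0 qm) (monic_neq0 qm1).
  exact: (mulf_neq0 (mulf_neq0 (mulf_neq0 q12 Xm1) crit0) gam0).
have badP s : ~~ root bad s -> [/\ (qint m).[s] != 0, (qint m.-1).[s] != 0, s != 1,
    ~~ root crit s & ~~ root gam s].
  rewrite /bad !rootM !negb_or root_XsubC.
  by move=> /andP[/andP[/andP[/andP[h1 h2] h3] h4] h5]; split.
have N2 : (0 < N.*2)%N by rewrite double_gt0.
have [a [rs [urs srs rsP rsbad]]] := generic_pencil mA mB sA sB N2 cop bad0.
pose f : {poly R[i]} := fm m; pose x := @cx R m; pose y := @cy R m.
pose g : {poly R[i]} := 'X^n + a *: 'X.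
have szf : size f = m.+1 by exact: size_fm.
have szg : size g = n.+1.
  rewrite /g size_polyDl size_polyXn //.
  by apply: leq_ltn_trans (size_scale_leq _ _) _; rewrite size_polyX ltnS.
have pencil_eq s : (qint m).[s] != 0 ->
    (g.[x s] - g.[y s]) * (qint m).[s] ^+ n =
    (1 - s) * (qint m.-1).[s] * (qint (gcdn m n)).[s] * (A + a *: B).[s].
  move=> D; have ea := congr1 (horner^~ s) EA; have eb := congr1 (horner^~ s) EB.
  rewrite !(hornerM, horner_exp) in ea eb.
  have xE := cx_eq D; have nE := qint_horner n s.
  have -> : (1 - s) * (qint m.-1).[s] * (qint (gcdn m n)).[s] * (A + a *: B).[s] =
     (1 - s) * (qint m.-1).[s] *
     ((qint (gcdn m n)).[s] * A.[s] + a * ((qint (gcdn m n)).[s] * B.[s])).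
    by rewrite hornerD hornerZ; ring.
  have sn : s ^+ n = 1 + (s - 1) * (qint n).[s] by rewrite nE addrC subrK.
  have gd : g.[x s] - g.[y s] = x s ^+ n - s ^+ n * x s ^+ n + a * (x s - s * x s).
    rewrite /g /y /cy -/(x s) !(hornerD, hornerZ, hornerX, hornerXn).
    by rewrite [(s * x s) ^+ n]exprMn; ring.
  have e1 (z : R[i]) : z ^+ n = z * z ^+ n.-1 by rewrite -exprS prednK.
  rewrite ea eb gd -xE -/(x s) sn [(x s * _) ^+ _]exprMn (e1 (x s)) (e1 (qint m).[s]).
  ring.
have neq s : (qint m).[s] != 0 -> (qint m.-1).[s] != 0 -> s != 1 -> x s != 0 /\ x s != y s.
  move=> D D1 s1; have x0 : x s != 0 by rewrite mulf_neq0 // invr_eq0.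
  split => //; rewrite -subr_eq0 /y /cy -/x -[X in X - _]mul1r -mulrBl mulf_neq0 //.
  by rewrite subr_eq0 eq_sym.
have gE s : s \in rs -> g.[x s] = g.[y s].
  move=> srs'; have [D _ _ _ _] := badP _ (rsbad _ srs').
  apply/eqP; rewrite -subr_eq0 -(mulIr_eq0 _ (mulIf (expf_neq0 n D))) pencil_eq //.
  by move: srs'; rewrite -rsP rootE => /eqP ->; rewrite mulr0.
have dqE s : s \in rs -> dq 'X^n (x s) (y s) = - a.
  move=> srs'; have [D D1 s1 _ _] := badP _ (rsbad _ srs').
  have [_ xy] := neq _ D D1 s1; rewrite -subr_eq0 in xy.
  apply: (mulfI xy); rewrite -dqP !hornerXn.
  have := gE _ srs'; rewrite /g !(hornerD, hornerZ, hornerX, hornerXn) => /eqP.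
  rewrite -subr_eq0 => /eqP e.
  apply/eqP; rewrite -subr_eq0; apply/eqP; rewrite -[RHS]e; ring.
have regP s : ~~ root bad s -> (qint m).[s] != 0 /\ ~ critical_values f f.[x s].
  by move=> /badP[D _ _ cr _]; split => //; exact: critP.
(* the base pair of the cycle; there is one because [0 < N] *)
case rsE : rs => [|sb rs0]; first by rewrite rsE in srs; rewrite -srs in N2.
have sbrs : sb \in rs by rewrite rsE mem_head.
set t0 : C := f.[x sb].
have [Db Db1 sb1 _ _] := badP _ (rsbad _ sbrs).
have [_ xyb] := neq _ Db Db1 sb1.
have [_ regb] := regP _ (rsbad _ sbrs).
have [zi [zi0 bi]] := local_inverse (regular_deriv regb).
have yfib : f.[y sb] = t0 by rewrite /t0 (curve_fibre m1 Db).
have regb' : ~ critical_values f f.[y sb] by rewrite yfib.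
have [zj [zj0 bj]] := local_inverse (regular_deriv regb').
rewrite yfib in zj0 bj.
have cyc : simple_cycle f t0 zi zj.
  by split; [exact: bi|exact: bj|rewrite zi0 zj0].
exists f, g, t0, zi, zj.
have adm : admissible m n f g t0 zi zj by split.
split; first exact: adm.
have Vin s : s \in rs -> vanishing_set f g t0 zi zj f.[x s].
  move=> srs'; apply/(vanishing_setP g _ cyc); exists (x s), (y s).
  split; [|by []|exact: gE].
  rewrite zi0 zj0; apply: (linked_curve m1 bad0 regP); exact: rsbad.
have Vfin t : vanishing_set f g t0 zi zj t -> t \in (0 : C) :: [seq (f.[x s] : C) | s <- rs].
  move=> /(vanishing_setP g _ cyc)[x1 [y1 [lk ft gt]]].
  have xy1 : x1 != y1 by apply: (linked_neq lk); rewrite /= zi0 zj0.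
  have [/= ff _] := linked_eq_fibre lk.
  rewrite inE -ft; have [->|x10] := eqVneq x1 0.
    by rewrite /f (fm_horner m1) expr0n eqn0Ngt mp0 mul0r eqxx.
  have [D [xE yE]] := curve_param m1 x10 xy1 ff; set s := y1 / x1 in D xE yE.
  have s1 : 1 - s != 0.
    rewrite subr_eq0 eq_sym; apply: contraNneq xy1 => s1.
    by rewrite xE yE /cy s1 mul1r.
  have D1 : (qint m.-1).[s] != 0.
    by apply: contraNneq x10 => e; rewrite xE /cx e mul0r.
  have Dd : (qint (gcdn m n)).[s] != 0.
    have [Q QE] := @qint_dvd R[i] (gcdn m n) (m %/ gcdn m n).
    rewrite mulnC divnK ?dvdn_gcdl // in QE.
    by apply: contraNneq D => e; rewrite QE hornerM e mul0r.
  have := pencil_eq s D; rewrite /x /y -xE -yE gt subrr mul0r => /esym/eqP.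
  rewrite mulf_eq0 (negbTE (mulf_neq0 (mulf_neq0 s1 D1) Dd)) /= => rt.
  by apply/orP; right; apply/mapP; exists s; [rewrite -rsP | rewrite /x -xE].
rewrite card_eq_le; apply/andP; split.
  exact: (zeros_card_le m1 n0 NE adm).
pose ts := undup [seq (f.[x s] : C) | s <- rs].
have Nts : (N <= size ts)%N.
  apply: (@size_undup_two_to_one _ _ (fun s => f.[x s] : C) GRing.inv rs N urs srs).
  move=> s s' srs1 srs2 e.
  have [D D1 s1 _ gs] := badP _ (rsbad _ srs1).
  have [D' D1' s1' _ _] := badP _ (rsbad _ srs2).
  have [x0 xy] := neq _ D D1 s1; have [x0' xy'] := neq _ D' D1' s1'.
  have [_ reg] := regP _ (rsbad _ srs1).
  exact: (same_fibre m1 gamP D D' x0 x0' xy xy' gs reg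
    (dqE _ srs1) (dqE _ srs2) e).
have sub : [set` ts] `<=` zeros f g t0 zi zj.
  move=> t /=; rewrite /ts mem_undup => /mapP[s srs' ->].
  by apply: (finite_isolated Vfin); exact: Vin.
apply: card_le_trans (subset_card_le sub).
have img : (nth 0 ts) @` `I_N `<=` [set` ts].
  by move=> _ [k /= kN <-]; rewrite /= mem_nth // (leq_trans kN).
apply: card_le_trans (subset_card_le img).
have inj : {in `I_N &, injective (nth 0 ts)}.
  move=> k l; rewrite !inE /= => kN lN /eqP.
  by rewrite nth_uniq ?undup_uniq ?(leq_trans kN) ?(leq_trans lN) // => /eqP.
by have := inj_card_eq inj; rewrite card_eq_le => /andP[].
Qed.

(** The degenerate case, where no integral has an isolated zero, so that any cycle
    attains the bound. *)
Lemma attained_zero m n : (1 < m)%N -> (0 < n)%N ->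
  ((gcdn m n).-1 = n.-1 * m.-1)%N ->
  exists (f g : {poly R[i]}) (t0 : C) (zi zj : C -> C),
    admissible m n f g t0 zi zj /\ zeros f g t0 zi zj #= `I_0.
Proof.
move=> m1 n0 NE; have m0 : (0 < m)%N by exact: ltnW.
have [w wp] := exists_prim_root R[i] m0.
pose f : {poly R[i]} := 'X^m.
have f1 : f.[1] = 1 by rewrite hornerXn expr1n.
have fw : f.[w] = 1 by rewrite hornerXn (prim_expr_order wp).
have df z : z != 0 -> f^`().[z] != 0.
  by move=> z0; rewrite derivXn hornerMn hornerXn mulrn_eq0 negb_or -lt0n m0 expf_neq0.
have reg : ~ critical_values f 1.
  move=> [c /= rc fc]; have c0 : c != 0.
    apply/eqP => c0; move: fc; rewrite c0 hornerXn expr0n eqn0Ngt m0 => /eqP.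
    by rewrite eq_sym oner_eq0.
  by move: rc; rewrite rootE (negbTE (df _ c0)).
have w0 : w != 0 by rewrite (prim_root_eq0 wp) -lt0n.
have [zi [zi0 bi]] := local_inverse (df _ (oner_neq0 _)).
have [zj [zj0 bj]] := local_inverse (df _ w0).
rewrite f1 in zi0 bi; rewrite fw in zj0 bj.
exists f, 'X^n, 1, zi, zj.
have adm : admissible m n f 'X^n 1 zi zj.
  split; rewrite ?size_polyXn //; split; [exact: bi|exact: bj|].
  rewrite zi0 zj0 eq_sym -[w]expr1 -(prim_order_dvd wp) gtnNdvd //.
split; first exact: adm.
rewrite card_eq_le; apply/andP; split.
  by apply: (zeros_card_le m1 n0 _ adm); rewrite double0 add0n.
by rewrite II0; exact: card_ge0.
Qed.

End Attained.

Lemma count_formula m n : (0 < m)%N -> (0 < n)%N ->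
  exists N, (N.*2 + (gcdn m n).-1 = n.-1 * m.-1)%N.
Proof.
move=> m0 n0.
have d0 : (0 < gcdn m n)%N by rewrite gcdn_gt0 m0.
have le : ((gcdn m n).-1 <= n.-1 * m.-1)%N.
  have dn : (gcdn m n <= n)%N by rewrite dvdn_leq // dvdn_gcdr.
  have dm : (gcdn m n <= m)%N by rewrite dvdn_leq // dvdn_gcdl.
  nia.
exists (n.-1 * m.-1 - (gcdn m n).-1)./2.
rewrite even_halfK ?subnK // oddB // oddM.
have oddp k : (0 < k)%N -> odd k.-1 = ~~ odd k by case: k => // k _; rewrite negbK.
rewrite !oddp //.
case om: (odd m).
  have : odd (gcdn m n) by apply: dvdn_odd om; exact: dvdn_gcdl.
  by move=> ->; rewrite andbF.
case on: (odd n).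
  have : odd (gcdn m n) by apply: dvdn_odd on; exact: dvdn_gcdr.
  by move=> ->.
have : (2 %| gcdn m n)%N by rewrite dvdn_gcd !dvdn2 om on.
by rewrite dvdn2 => /negbTE ->.
Qed.

Theorem theorem6p5 (R : realType) (m n : nat) (hm : (1 < m)%N) (hn : (0 < n)%N) :
  exists N : nat, is_Z1S R m n N /\
    N%:R = ((n%:R - 1) * (m%:R - 1) - ((gcdn m n)%:R - 1)) / 2 :> rat.
Proof.
have m0 : (0 < m)%N by exact: ltnW.
have [N NE] := count_formula m0 hn.
have d0 : (0 < gcdn m n)%N by rewrite gcdn_gt0 m0.
exists N; split; last first.
  have pred1 k : (0 < k)%N -> (k%:R - 1 : rat) = k.-1%:R.
    by case: k => // k _; rewrite -natr1 addrK.
  rewrite !pred1 // -natrM -NE natrD addrK -muln2 natrM mulfK //.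
split; last first.
  move=> f g t0 zi zj adm; exact: (zeros_card_le hm hn NE adm).
have [N0|N0] := posnP N.
  by subst N; apply: attained_zero => //; rewrite -NE double0.
apply: attained_pos => //.
rewrite ltn_neqAle hn andbT; apply: contraTneq N0 => n1.
by move: NE; rewrite -n1 gcdn1 mul0n; case: N.
Qed.
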